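(* Let $\lambda$ be a partition of $n$ and let $d>1$ be an integer. Let $\kappa_d^\lambda$ be the $d$th cumulant of the random variable $\mathrm{maj}(T)$, where $T$ is chosen uniformly at random from the set $\mathrm{SYT}(\lambda)$ of standard Young tableaux of shape $\lambda$. Then $$\kappa_d^\lambda = \frac{B_d}{d}\left[\sum_{j=1}^n j^d - \sum_{c\in\lambda} h_c^d\right],$$ where $B_d$ is the $d$th Bernoulli number and $h_c$ is the hook length of the cell $c$ of $\lambda$.
   Context: Diagrams are drawn in English notation (row 1 at the top). A standard Young tableau of shape $\lambda\vdash n$ is a bijective filling of the cells of $\lambda$ with $1,\ldots,n$ increasing to the right along rows and downward along columns. An integer $i\in\{1,\dots,n-1\}$ is a descent of $T$ if $i+1$ lies in a strictly lower row of $T$ than $i$; $\mathrm{maj}(T)$ is the sum of the descents of $T$. The hook length $h_c$ of a cell $c$ is the number of cells of $\lambda$ in the same row as $c$ to its right, or in the same column as $c$ below it, including $c$ itself once. The sum over $c\in\lambda$ is over all cells of the Young diagram. The cumulants $\kappa_1,\kappa_2,\ldots$ of a random variable $X$ are defined by $\sum_{d\ge1}\kappa_d\, t^d/d! = \log \mathbb{E}[e^{tX}]$. The Bernoulli numbers are defined by $\sum_{d\ge0}B_d\,t^d/d! = t/(1-e^{-t})$, so $B_0,B_1,B_2,\ldots = 1,\tfrac12,\tfrac16,0,-\tfrac1{30},0,\tfrac1{42},0,\ldots$. *)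

(* Defs.v *)
From HB Require Import structures.
From mathcomp Require Import all_boot all_order all_algebra.
From mathcomp Require Import all_classical all_reals all_analysis.

Set Implicit Arguments.
Unset Strict Implicit.
Unset Printing Implicit Defensive.

Import Order.TTheory GRing.Theory Num.Theory.
Import numFieldNormedType.Exports.

Local Open Scope nat_scope.

Definition is_partition (n : nat) (lam : seq nat) : bool :=
  [&& sorted geq lam, 0 \notin lam & sumn lam == n].

(* Rows and columns are numbered from 0; row 0 is the top row, so "lower"
   means a larger row index. *)
Definition cell (lam : seq nat) : Type :=
  {i : 'I_(size lam) & 'I_(nth 0 lam i)}.

HB.instance Definition _ (lam : seq nat) :=
  Finite.copy (cell lam) {i : 'I_(size lam) & 'I_(nth 0 lam i)}.

Definition cell_row (lam : seq nat) (c : cell lam) : nat := tag c.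
Definition cell_col (lam : seq nat) (c : cell lam) : nat := tagged c.

Definition hook_length (lam : seq nat) (c : cell lam) : nat :=
  #|[set c' : cell lam |
      (cell_row c' == cell_row c) && (cell_col c <= cell_col c')
   || (cell_col c' == cell_col c) && (cell_row c <= cell_row c')]|.

(* The entry of the cell c is (T c).+1, so that entries range over 1, ..., n. *)
Definition is_syt (n : nat) (lam : seq nat) (T : {ffun cell lam -> 'I_n})
    : bool :=
  [&& injectiveb T,
      [forall i, exists c, T c == i],
      [forall c, forall c', (cell_row c == cell_row c')
                              && (cell_col c < cell_col c') ==> (T c < T c')]
    & [forall c, forall c', (cell_col c == cell_col c')
                              && (cell_row c < cell_row c') ==> (T c < T c')]].

Definition syt (n : nat) (lam : seq nat) : Type :=
  {T : {ffun cell lam -> 'I_n} | is_syt T}.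

HB.instance Definition _ (n : nat) (lam : seq nat) :=
  SubFinite.copy (syt n lam) {T : {ffun cell lam -> 'I_n} | is_syt T}.

Definition entry (n : nat) (lam : seq nat) (T : syt n lam) (c : cell lam)
    : nat :=
  (val T c).+1.

Definition is_descent (n : nat) (lam : seq nat) (T : syt n lam) (i : nat)
    : bool :=
  [exists c, exists c', [&& entry T c == i, entry T c' == i.+1
                          & cell_row c < cell_row c']].

Definition maj (n : nat) (lam : seq nat) (T : syt n lam) : nat :=
  \sum_(1 <= i < n | is_descent T i) i.

Local Open Scope classical_set_scope.
Local Open Scope ring_scope.

Definition uniformly_distributed (d : measure_display)
    (Omega : measurableType d) (R : realType) (P : probability Omega R)
    (A : finType) (T : Omega -> A) : Prop :=
  forall a : A, measurable (T @^-1` [set a]) /\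
    P (T @^-1` [set a]) = (#|A|%:R^-1)%:E.

(* The value kappa 0 is left unconstrained: the sum starts at d = 1. *)
Definition has_cumulants (d : measure_display) (Omega : measurableType d)
    (R : realType) (P : probability Omega R) (X : Omega -> R)
    (kappa : nat -> R) : Prop :=
  \forall t \near (0 : R),
    'M_P X t \is a fin_num /\
    (fun N => \sum_(1 <= k < N) kappa k * t ^+ k / k`!%:R) @ \oo
      --> ln (fine ('M_P X t)).

(* A power series expansion near 0 has uniquely determined coefficients, so
   the choice made by xget is irrelevant (for k > 0). *)
Definition cumulant (d : measure_display) (Omega : measurableType d)
    (R : realType) (P : probability Omega R) (X : Omega -> R) (k : nat) : R :=
  xget (fun=> 0) [set kappa : nat -> R | has_cumulants P X kappa] k.

(* The right-hand side has a removable singularity at t = 0, hence the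
   punctured neighborhood; with this sign convention B_1 = 1/2. *)
Definition is_bernoulli (R : realType) (B : nat -> R) : Prop :=
  \forall t \near (0 : R)^',
    (fun N => \sum_(0 <= k < N) B k * t ^+ k / k`!%:R) @ \oo
      --> t / (1 - expR (- t)).

Definition bernoulli_number (R : realType) (k : nat) : R :=
  xget (fun=> 0) [set B : nat -> R | is_bernoulli B] k.

(* Main.v *)
Require Import Defs.
From HB Require Import structures.
From mathcomp Require Import all_boot all_order all_algebra.
From mathcomp Require Import all_classical all_reals all_analysis.
From mathcomp Require Import measurable_realfun.
From mathcomp Require Import ring lra zify.

(* With lambda_i + m - i the beta numbers of lambda, row by row removal of the
   last letter of a lattice word shows that the generating function of maj,
   refined by the last letter, obeys the same recursion as a determinant whose
   rows are differences of q^(j a) / (q;q)_(a - 1), where a runs over the beta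
   numbers.  That determinant is essentially a Vandermonde determinant, which
   yields the q-hook length formula
     sum_T q^(maj T) * prod_c (1 - q^(h_c)) = q^b * prod_(k = 1)^n (1 - q^k),
   with b = sum_i i lambda_i (rows numbered from 0).
   Put q = e^t.  If B(x) = x / (1 - e^(-x)) = sum_k B_k x^k / k! and
   S(x) = sum_(k >= 1) (B_k / k) x^k / k!, then e^x - 1 = x e^(S(x)), because
   B e^(S(x) - x) has derivative 0 and value 1 at 0.  Hence the logarithm of the
   moment generating function is b t + sum_(j <= n) S(j t) - sum_c S(h_c t), and
   the cumulants are read off from its coefficients. *)

Set Implicit Arguments.
Unset Strict Implicit.
Unset Printing Implicit Defensive.

Import Order.TTheory GRing.Theory Num.Theory.
Import numFieldNormedType.Exports.

Local Open Scope ring_scope.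

(** * Words of rows, built from the last letter *)

Definition dec_row (lam : nat -> nat) (r : nat) : nat -> nat :=
  fun i => (lam i - (i == r))%N.

(** The last letter stands for the row of the largest entry, so that row must end in a removable
    corner. [mem_lattice_words] identifies these words with the usual lattice words of content
    [lam]. *)
Fixpoint lattice_words (m n : nat) (lam : nat -> nat) : seq (seq nat) :=
  if n is n'.+1 then
    flatten [seq [seq rcons w r | w <- lattice_words m n' (dec_row lam r)]
            | r <- iota 0 m & (lam r.+1 < lam r)%N]
  else [:: [::]].

(** The letter at index [i.-1] stands for the row of the entry [i], so a descent of a tableau at [i]
    is an ascent of its word. *)
Definition word_maj (w : seq nat) : nat :=
  (\sum_(1 <= i < size w | nth 0 w i.-1 < nth 0 w i) i)%N.

Definition row_shape (m n : nat) (lam : nat -> nat) : Prop :=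
  [/\ forall i, (lam i.+1 <= lam i)%N, lam m = 0%N
    & (\sum_(0 <= i < m) lam i)%N = n].

Lemma row_shape_homo m n lam i j :
  row_shape m n lam -> (i <= j)%N -> (lam j <= lam i)%N.
Proof.
move=> [mono _ _] /subnKC <-; elim: (j - i)%N => [|k IHk]; first by rewrite addn0.
by rewrite addnS; apply: leq_trans (mono _) IHk.
Qed.

Lemma row_shape_dec m n lam r :
  row_shape m n.+1 lam -> (r < m)%N -> (lam r.+1 < lam r)%N ->
  row_shape m n (dec_row lam r).
Proof.
move=> [mono lam0 sum_lam] rm lt_r; split=> [i||]; rewrite /dec_row.
- have := mono i; case: (eqVneq i r) => [->|] /=; lia.
- by rewrite lam0.
apply: succn_inj; rewrite -sum_lam -add1n.
have -> : 1%N = (\sum_(0 <= i < m) (i == r))%N.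
  rewrite big_mkord (bigD1 (Ordinal rm)) //= eqxx big1 ?addn0 // => i /negPf.
  by rewrite -val_eqE /= => ->.
rewrite -big_split; apply: eq_bigr => i _ /=.
by case: eqVneq => [->|_] /=; lia.
Qed.

(** The default letter of [last] does no harm: for an empty word its term is multiplied by [size w],
    which is 0. *)
Lemma word_maj_rcons w r :
  word_maj (rcons w r) = (word_maj w + (last 0%N w < r) * size w)%N.
Proof.
rewrite /word_maj size_rcons.
case: (posnP (size w)) => [/size0nil ->|w_gt0].
  by rewrite !big_geq ?muln0.
rewrite big_mkcond big_nat_recr //= -big_mkcond /=; congr (_ + _)%N.
  rewrite big_nat_cond [RHS]big_nat_cond; apply: eq_bigl => i.
  case: (boolP (0 < i < size w)%N) => //= /andP[i_gt0 i_lt]; rewrite !nth_rcons i_lt.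
  by rewrite (leq_ltn_trans (leq_pred i) i_lt).
rewrite !nth_rcons ltnn eqxx ltn_predL w_gt0 nth_last.
by case: ltnP => _; rewrite ?mul1n ?mul0n.
Qed.

Lemma size_lattice_words m n lam w : w \in lattice_words m n lam -> size w = n.
Proof.
elim: n lam w => [|n IHn] lam w /=; first by rewrite inE => /eqP ->.
by case/flatten_mapP => r _ /mapP[w' /IHn <- ->]; rewrite size_rcons.
Qed.

Lemma big_lattice_words (V : nmodType) m n lam (G : seq nat -> V) :
  \sum_(w <- lattice_words m n.+1 lam) G w =
  \sum_(0 <= r < m | (lam r.+1 < lam r)%N)
     \sum_(w <- lattice_words m n (dec_row lam r)) G (rcons w r).
Proof.
rewrite /= big_flatten big_map big_filter /index_iota subn0.
by apply: eq_bigr => r _; rewrite big_map.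
Qed.

(** * A determinant with the same recursion as the sums over words *)

Section Determinant.

Variables (F : fieldType) (q : F).
Hypothesis q_neq1 : forall k, q ^+ k.+1 != 1.

Definition qfact (l : nat) : F := \prod_(k < l) (1 - q ^+ k.+1).

Lemma qfact_neq0 l : qfact l != 0.
Proof. by apply/prodf_neq0 => k _; rewrite subr_eq0 eq_sym. Qed.

Lemma qfactS l : qfact l.+1 = qfact l * (1 - q ^+ l.+1).
Proof. by rewrite /qfact big_ord_recr. Qed.

Variable m : nat.

(* The value at [a = 0] stands for 1 / (q;q)_(-1) = 0; it makes [psi_sub_pred]
   hold for [l = 0]. *)
Definition psi (j a : nat) : F :=
  if a is l.+1 then q ^+ (j * a) / qfact l else 0.

(** One more than the customary lambda_i + m - 1 - i. With this shift a shape with [lam m = 0] has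
    value 0 at the index [m], where [psi] vanishes. *)
Definition beta_number (lam : nat -> nat) (i : nat) : nat := (lam i + (m - i))%N.

(* By multilinearity in the rows and telescoping, the determinant of this matrix
   is proportional to the sum of q^|mu| (gf of mu) / (q;q)_|mu| over all mu
   obtained from [lam] by deleting a horizontal strip in the rows [>= r]. *)
Definition strip_mx (lam : nat -> nat) (r : nat) : 'M[F]_m :=
  \matrix_(i, j) (psi j (beta_number lam i)
    - psi j (if (i < r)%N then (beta_number lam i).-1 else beta_number lam i.+1)).

(** Let a and a' be the beta numbers of [r] and [r.+1]. Row [r] splits as (psi(a) - psi(a - 1)) +
    (psi(a - 1) - psi(a')). Removing a cell from row [r] lowers a by 1; if no cell can be removed,
    then a - 1 = a' and the second part is 0. *)
Lemma det_strip_rec n lam r : row_shape m n lam -> (r < m)%N ->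
  \det (strip_mx lam r) = \det (strip_mx lam r.+1)
    + (if (lam r.+1 < lam r)%N then \det (strip_mx (dec_row lam r) r) else 0).
Proof.
move=> [mono lam0 _] rm; pose r' := Ordinal rm.
have -> : (if (lam r.+1 < lam r)%N then \det (strip_mx (dec_row lam r) r) else 0)
   = \det (\matrix_(i, j) if i == r'
        then psi j (beta_number lam r).-1 - psi j (beta_number lam r.+1)
        else strip_mx lam r i j).
  case: ltnP => [lt_r|ge_r]; last first.
    rewrite (expand_det_row _ r') big1 // => j _; rewrite !mxE eqxx.
    have -> : (beta_number lam r).-1 = beta_number lam r.+1.
      by rewrite /beta_number; have := mono r; lia.
    by rewrite subrr mul0r.
  congr (\det _); apply/matrixP => i j; rewrite !mxE.
  case: eqP => [->|/eqP]; rewrite /=.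
    rewrite ltnn; congr (psi _ _ - psi _ _); rewrite /beta_number /dec_row ?eqxx.
      by lia.
    by rewrite [(r.+1 == r)]gtn_eqF // subn0.
  rewrite -val_eqE /= => ir; rewrite /beta_number /dec_row (negPf ir) subn0.
  by case: ltnP => // ri; rewrite [(i.+1 == r)]gtn_eqF ?ltnS ?subn0 //.
rewrite -[X in X + _]mul1r -[X in _ + X]mul1r.
apply: (@determinant_multilinear _ _ _ _ _ r').
- apply/rowP => j; rewrite !mxE eqxx !mul1r /= ltnn ltnSn; ring.
- apply/matrixP => i j; rewrite !mxE ltnS leq_eqVlt.
  by have /negPf := neq_lift r' i; rewrite eq_sym -val_eqE /= => ->.
- by apply/matrixP => i j; rewrite !mxE eq_sym (negPf (neq_lift _ _)).
Qed.

Definition psi_mx (lam : nat -> nat) : 'M[F]_m :=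
  \matrix_(i, j) psi j (beta_number lam i).

(** Taking differences of consecutive rows is multiplication by a unitriangular matrix; the row
    after the last one would be [psi] at 0, that is 0. *)
Lemma det_strip0 n lam : row_shape m n lam ->
  \det (strip_mx lam 0) = \det (psi_mx lam).
Proof.
move=> [_ lam0 _].
pose U : 'M[F]_m := \matrix_(i, k) ((k == i)%:R - (k == i.+1 :> nat)%:R).
have detU : \det U = 1.
  rewrite -det_tr det_trig; last first.
    apply/is_trig_mxP => i j ij; rewrite !mxE.
    by rewrite -!val_eqE /= !ltn_eqF ?subrr // ltnS ltnW.
  by rewrite big1 // => i _; rewrite !mxE eqxx ltn_eqF // subr0.
rewrite -[RHS]mul1r -detU -det_mulmx; congr (\det _).
apply/matrixP => i j; rewrite !mxE ltn0.
under eq_bigr => k _ do rewrite !mxE mulrBl.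
rewrite sumrB; congr (_ - _).
  rewrite (bigD1 i) //= eqxx mul1r big1 ?addr0 // => k /negPf -> //.
  by rewrite mul0r.
case: (ltnP i.+1 m) => [im|mi].
  rewrite (bigD1 (Ordinal im)) //= eqxx mul1r big1 ?addr0 // => k.
  by rewrite -val_eqE /= => /negPf ->; rewrite mul0r.
rewrite big1 => [|k _]; last by rewrite ltn_eqF ?mul0r // (leq_trans (ltn_ord k)).
have -> : i.+1 = m by apply/eqP; rewrite eqn_leq ltn_ord.
by rewrite /beta_number lam0 subnn.
Qed.

Definition vdm_mx (lam : nat -> nat) : 'M[F]_m :=
  \matrix_(i, j) (q ^+ (beta_number lam i).-1 ^+ j).

Lemma beta_number_gt0 lam i : (i < m)%N -> (0 < beta_number lam i)%N.
Proof. by rewrite /beta_number; lia. Qed.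

Lemma det_psi_mx lam : \det (psi_mx lam) =
  (\prod_(j < m) q ^+ j) * (\prod_(i < m) (qfact (beta_number lam i).-1)^-1)
  * \det (vdm_mx lam).
Proof.
have -> : psi_mx lam = diag_mx (\row_i (qfact (beta_number lam i).-1)^-1)
   *m vdm_mx lam *m diag_mx (\row_j q ^+ j).
  apply/matrixP => i j; rewrite mul_mx_diag mul_diag_mx !mxE.
  have := beta_number_gt0 lam (ltn_ord i); case: (beta_number lam i) => //= l _.
  by rewrite /psi mulnS exprD mulnC exprM; ring.
rewrite !det_mulmx !det_diag mulrC mulrA; congr (_ * _ * _);
  by apply: eq_bigr => i _; rewrite mxE.
Qed.

(** Since 1 / (q;q)_(l - 1) = (1 - q^l) / (q;q)_l, both terms get the denominator (q;q)_l. With x =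
    q^l, the row factor leaves the monic polynomial x^j + (q^j - 1) x^(j - 1), which is
    unitriangular over the monomials. *)
Lemma psi_sub_pred j l :
  psi j l.+1 - psi j l = q ^+ l / qfact l
    * (q ^+ l ^+ j + (q ^+ j - 1) * (if j is i.+1 then q ^+ l ^+ i else 0)).
Proof.
have nz := qfact_neq0.
case: l => [|l] /=.
  rewrite /psi muln1 /qfact big_ord0 subr0 !divr1 mul1r.
  by case: j => [|j]; rewrite ?expr0 ?expr1n; ring.
rewrite qfactS; have := q_neq1 l; rewrite -subr_eq0 => nl.
have nl' : 1 - q ^+ l.+1 != 0 by rewrite -opprB oppr_eq0.
have -> : q ^+ (j * l.+2) = q ^+ j * q ^+ l.+1 ^+ j.
  by rewrite mulnS exprD mulnC exprM.
have -> : q ^+ (j * l.+1) = q ^+ l.+1 ^+ j by rewrite mulnC exprM.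
set x := q ^+ l.+1 in nl nl' *.
case: j => [|j]; first by rewrite !expr0; field; rewrite nz nl'.
by rewrite [x ^+ j.+1]exprS; field; rewrite nz nl'.
Qed.

Lemma det_stripm lam : \det (strip_mx lam m) =
  (\prod_(i < m) (q ^+ (beta_number lam i).-1 / qfact (beta_number lam i).-1))
  * \det (vdm_mx lam).
Proof.
(* Column [j] lists the coefficients of the polynomial x^j + (q^j - 1) x^(j - 1) from
   [psi_sub_pred]. *)
pose C : 'M[F]_m := \matrix_(k, j)
  ((k == j)%:R + (q ^+ j - 1) * (k.+1 == j :> nat)%:R).
have detC : \det C = 1.
  rewrite -det_tr det_trig; last first.
    apply/is_trig_mxP => i j ij; rewrite !mxE.
    by rewrite -!val_eqE /= !gtn_eqF ?mulr0 ?addr0 // ltnS ltnW.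
  by rewrite big1 // => i _; rewrite !mxE eqxx gtn_eqF // mulr0 addr0.
have -> : strip_mx lam m =
   diag_mx (\row_i (q ^+ (beta_number lam i).-1 / qfact (beta_number lam i).-1))
   *m (vdm_mx lam *m C).
  apply/matrixP => i j; rewrite mul_diag_mx !mxE ltn_ord.
  have := beta_number_gt0 lam (ltn_ord i); case bE: (beta_number lam i) => [//|l] _.
  rewrite psi_sub_pred; congr (_ * _).
  under eq_bigr => k _ do rewrite !mxE bE mulrDr.
  rewrite big_split /=; congr (_ + _).
    rewrite (bigD1 j) //= eqxx mulr1 big1 ?addr0 // => k /negPf -> //.
    by rewrite mulr0.
  case jE: (val j) => [|j'].
    by rewrite mulr0 big1 // => k _; rewrite !mulr0.
  have jm : (j' < m)%N by apply: ltnW; rewrite -jE ltn_ord.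
  rewrite (bigD1 (Ordinal jm)) //= eqxx big1 ?addr0; last first.
    by move=> k; rewrite -val_eqE eqSS /= => /negPf ->; rewrite !mulr0.
  by rewrite mulr1 mulrC.
rewrite !det_mulmx det_diag detC mulr1; congr (_ * _).
by apply: eq_bigr => i _; rewrite mxE.
Qed.

(** Both sides are multiples of the same Vandermonde determinant. The row factors q^(a - 1) on the
    left and the column factors q^j on the right differ by q^n, because the numbers a - 1 add up to
    n + (0 + ... + (m - 1)). *)
Lemma det_strip_m0 n lam : row_shape m n lam ->
  \det (strip_mx lam m) = q ^+ n * \det (strip_mx lam 0).
Proof.
move=> shp; rewrite (det_strip0 shp) det_psi_mx det_stripm !mulrA; congr (_ * _).
have -> : (\prod_(i < m) (q ^+ (beta_number lam i).-1 / qfact (beta_number lam i).-1)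
  = (\prod_(i < m) q ^+ (beta_number lam i).-1)
    * \prod_(i < m) (qfact (beta_number lam i).-1)^-1).
  by rewrite -big_split.
congr (_ * _).
have [_ _ <-] := shp; rewrite big_mkord -!expr_sum -exprD; congr (_ ^+ _).
rewrite [X in (_ + X)%N](reindex_inj rev_ord_inj) -big_split /=; apply: eq_bigr => i _.
by rewrite /beta_number; have := ltn_ord i; lia.
Qed.

(* The weight q^n of the words with last letter [< r] is chosen so that passing
   from [r] to [r.+1] changes the sum by a factor 1 - q^n on the words ending in
   [r], which turns [qfact n] into [qfact n.-1]: this matches [det_strip_rec]. *)
Definition wgf (n : nat) (lam : nat -> nat) (r : nat) : F :=
  (\sum_(w <- lattice_words m n lam)
     q ^+ word_maj w * (if (last 0%N w < r)%N then q ^+ n else 1)) / qfact n.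

Lemma wgf_rec n lam r : (r < m)%N ->
  wgf n.+1 lam r = wgf n.+1 lam r.+1
    + (if (lam r.+1 < lam r)%N then wgf n (dec_row lam r) r else 0).
Proof.
move=> rm; rewrite /wgf; apply/eqP; rewrite addrC -subr_eq -mulrBl -sumrB.
rewrite big_lattice_words big_mkcond big_mkord (bigD1 (Ordinal rm)) //=.
rewrite [X in _ + X]big1 ?addr0 => [|i]; last first.
  rewrite -val_eqE /= => ir; case: ifP => // _; rewrite big1 // => w _.
  by rewrite last_rcons [(i < r.+1)%N]ltnS [(i <= r)%N]leq_eqVlt (negPf ir) subrr.
case: ifP => _; last by rewrite mul0r.
rewrite !mulr_suml; apply/eqP; apply: eq_big_seq => w /size_lattice_words sw.
rewrite word_maj_rcons last_rcons ltnn ltnSn sw exprD mulr1 qfactS.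
have := q_neq1 n; rewrite -subr_eq0 => nl.
have nl' : 1 - q ^+ n.+1 != 0 by rewrite -opprB oppr_eq0.
have := qfact_neq0 n.
by case: ifP => _; rewrite ?mul1n ?mul0n ?expr0 => nz; field; rewrite nz.
Qed.

Lemma wgf_m0 n lam : (0 < m)%N -> wgf n lam m = q ^+ n * wgf n lam 0.
Proof.
move=> m_gt0; rewrite /wgf mulrA mulr_sumr; congr (_ / _).
apply: eq_big_seq => w wP; rewrite ltn0 mulr1 mulrC; case: ifP => //.
suff -> : (last 0 w < m)%N by [].
case: n wP => [|n]; first by rewrite inE => /eqP ->.
case/flatten_mapP => r; rewrite mem_filter mem_iota => /and3P[_ _ rm].
by case/mapP => w' _ ->; rewrite last_rcons.
Qed.

(** By the two recursions and induction on [n], the difference E of the two sides satisfies E(s) =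
    E(s + 1), so E(m) = E(0). For n > 0 also E(m) = q^n E(0) with q^n != 1, which forces E = 0. For
    n = 0 the matrix does not depend on [r]. *)
Lemma wgf_det n lam r : row_shape m n lam -> (r <= m)%N ->
  wgf n lam r * \det (strip_mx (fun=> 0%N) 0) = \det (strip_mx lam r).
Proof.
elim: n lam r => [|n IHn] lam r shp rm.
  rewrite /wgf /= big_seq1 /word_maj big_geq // /qfact big_ord0 divr1 expr0.
  rewrite mul1r if_same mul1r.
  have lam0 i : (i <= m)%N -> lam i = 0%N.
    have [_ lamm /eqP] := shp; rewrite big_mkord sum_nat_eq0 => /forallP h.
    by rewrite leq_eqVlt => /orP[/eqP -> //|im]; have /eqP := h (Ordinal im).
  congr (\det _); apply/matrixP => i j; rewrite !mxE ltn0 /beta_number.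
  have := ltn_ord i; move=> im; rewrite !lam0 ?(ltnW im) //.
  by congr (_ - psi _ _); case: ifP => _; rewrite ?add0n; lia.
pose E r := wgf n.+1 lam r * \det (strip_mx (fun=> 0%N) 0) - \det (strip_mx lam r).
have Erec s : (s < m)%N -> E s = E s.+1.
  move=> sm; rewrite /E wgf_rec // (det_strip_rec shp) //.
  case: ifP => [lt_s|_]; last by rewrite !addr0.
  by rewrite mulrDl IHn ?(ltnW sm) //; [ring | apply: row_shape_dec].
have E0 s : (s <= m)%N -> E s = E 0%N.
  by elim: s => // s IHs sm; rewrite -Erec // IHs // ltnW.
have m_gt0 : (0 < m)%N.
  by case: (posnP m) => // m0; have [_ _] := shp; rewrite m0 big_geq.
suff : E r = 0 by move/eqP; rewrite subr_eq0 => /eqP.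
have : E m = q ^+ n.+1 * E 0%N.
  by rewrite /E wgf_m0 // (det_strip_m0 shp) mulrBr -mulrA.
rewrite !E0 // => /eqP; rewrite -subr_eq0 -{1}[E 0%N]mul1r -mulrBl mulf_eq0.
by rewrite subr_eq0 eq_sym (negPf (q_neq1 _)) => /eqP.
Qed.

(** * Hook lengths in a row and differences of beta numbers *)

Definition row_hook (lam : nat -> nat) (i c : nat) : nat :=
  (lam i - c + \sum_(i.+1 <= j < m) (c < lam j))%N.

Lemma sum_leq_size a b (p : nat -> bool) :
  (\sum_(a <= j < b) p j <= b - a)%N.
Proof.
by rewrite -[leqRHS](muln1 _) -sum_nat_const_nat; apply: leq_sum => j _; case: (p j).
Qed.

(** If row [j] reaches beyond column [c], the leg meets all rows i + 1, ..., j and the hook is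
    longer than the difference. Otherwise the leg ends above row [j] and the hook is shorter. *)
Lemma row_hook_neq n lam i c j : row_shape m n lam ->
  (c < lam i)%N -> (i < j < m)%N ->
  row_hook lam i c != ((beta_number lam i).-1 - (beta_number lam j).-1)%N.
Proof.
move=> shp ci /andP[ij jm]; have lij := row_shape_homo shp (ltnW ij).
have -> : ((beta_number lam i).-1 - (beta_number lam j).-1 = lam i - lam j + (j - i))%N.
  by rewrite /beta_number; clear shp; lia.
rewrite /row_hook (big_cat_nat (n := j)) //=; last exact: ltnW.
case: (ltnP c (lam j)) => cj.
  have -> : (\sum_(i.+1 <= k < j) (c < lam k) = j - i.+1)%N.
    rewrite -[RHS]muln1 -sum_nat_const_nat big_nat_cond [RHS]big_nat_cond.
    apply: eq_bigr => k /andP[/andP[_ /ltnW kj] _].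
    by rewrite (leq_trans cj) // (row_shape_homo shp).
  by rewrite big_ltn // cj gtn_eqF //; move: (bigop _ _ _) => u; clear shp; lia.
have -> : (\sum_(j <= k < m) (c < lam k) = 0)%N.
  rewrite big_nat_cond big1 // => k /andP[/andP[jk _] _].
  by rewrite ltnNge (leq_trans _ cj) // (row_shape_homo shp).
have := @sum_leq_size i.+1 j (fun k => (c < lam k)%N).
by move=> /= h; rewrite ltn_eqF //; move: (bigop _ _ _) h => u; clear shp; lia.
Qed.

Lemma row_hook_decr lam i c c' : (c < c')%N -> (c' < lam i)%N ->
  (row_hook lam i c' < row_hook lam i c)%N.
Proof.
move=> cc' c'i; rewrite /row_hook -addSn leq_add //; first by lia.
by apply: leq_sum => j _; case: (ltnP c' (lam j)) => // /(ltn_trans cc') ->.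
Qed.

(** Hooks decrease strictly along the row, the differences increase strictly with [j], and
    [row_hook_neq] keeps the two lists apart. All values lie between 1 and a - 1, where a is the
    beta number of [i], and there are a - 1 of them. *)
Lemma perm_row_hooks n lam i : row_shape m n lam -> (i < m)%N ->
  perm_eq ([seq row_hook lam i c | c <- iota 0 (lam i)]
    ++ [seq ((beta_number lam i).-1 - (beta_number lam j).-1)%N
       | j <- iota i.+1 (m - i.+1)])
    (iota 1 (beta_number lam i).-1).
Proof.
move=> shp im; set s := _ ++ _.
have s_uniq : uniq s.
  rewrite cat_uniq; apply/and3P; split.
  - rewrite map_inj_in_uniq ?iota_uniq // => c c'; rewrite !mem_iota /= !add0n.
    move=> ci c'i eq_h; case: (ltngtP c c') => // lt_c.
      by have := row_hook_decr lt_c c'i; rewrite eq_h ltnn.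
    by have := row_hook_decr lt_c ci; rewrite eq_h ltnn.
  - apply/hasPn => _ /mapP[j + ->]; rewrite mem_iota => jP.
    apply/mapP => -[c]; rewrite mem_iota => /= ci /esym/eqP; apply/negP.
    by apply: row_hook_neq shp _ _ => //; lia.
  - rewrite map_inj_in_uniq ?iota_uniq // => j j'; rewrite !mem_iota.
    move=> jP j'P; rewrite /beta_number.
    have h a b : (a <= b)%N -> (lam b <= lam a)%N by apply: row_shape_homo shp.
    case: (ltngtP j j') => // jj'.
      by have := h _ _ (ltnW jj'); have := h i j; lia.
    by have := h _ _ (ltnW jj'); have := h i j'; lia.
apply: uniq_perm; rewrite ?iota_uniq //.
apply: (uniq_min_size s_uniq _ _).2 => [k|].
  rewrite mem_cat mem_iota => /orP[] /mapP[c]; rewrite mem_iota => cP ->.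
    have := @sum_leq_size i.+1 m (fun k => (c < lam k)%N).
    by rewrite /row_hook /beta_number; lia.
  have := row_shape_homo shp (_ : i <= c)%N.
  by rewrite /beta_number; lia.
by rewrite size_cat !size_map !size_iota /beta_number; lia.
Qed.

Lemma prod_row_hooks n lam i (g : nat -> F) : row_shape m n lam -> (i < m)%N ->
  (\prod_(c < lam i) g (row_hook lam i c))
  * (\prod_(i.+1 <= j < m) g ((beta_number lam i).-1 - (beta_number lam j).-1)%N)
  = \prod_(k < (beta_number lam i).-1) g k.+1.
Proof.
move=> shp im; transitivity (\prod_(1 <= k < (beta_number lam i).-1.+1) g k); last first.
  by rewrite big_add1 big_mkord.
rewrite /index_iota subSS subn0 -(perm_big _ (perm_row_hooks shp im)) big_cat.
rewrite !big_map -(big_mkord xpredT (fun c => g (row_hook lam i c))).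
by rewrite /index_iota subn0.
Qed.

Hypothesis q_neq0 : q != 0.

(** With a_i the predecessor of the i-th beta number, this is the power of q that comes out when
    q^(a_j) is factored from each Vandermonde difference q^(a_j) - q^(a_i), i < j. The term of [j]
    occurs [j] times. *)
Lemma sum_beta_number_above n lam : row_shape m n lam ->
  (\sum_(i < m) \sum_(i.+1 <= j < m) (beta_number lam j).-1
   = \sum_(i < m) i * (m - i.+1) + \sum_(i < m) i * lam i)%N.
Proof.
move=> shp.
under eq_bigr => i _ do rewrite (big_nat_widenl _ 0%N) // big_mkord /=.
rewrite (exchange_big_dep xpredT) //= -big_split /=; apply: eq_bigr => j _.
rewrite sum_nat_const.
have -> : #|[pred i : 'I_m | (i < j)%N]| = j :> nat.
  by rewrite -sum1_card -(big_ord_widen m (fun=> 1%N)) ?sum1_card ?card_ord // ltnW.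
by rewrite -mulnDr addnC /beta_number; congr muln; have := ltn_ord j; lia.
Qed.

(** After this factoring, row [i] keeps the factors 1 - q^(a_i - a_j), j > i. Together with its
    hooks they form (q;q)_(a_i) by [prod_row_hooks], which cancels the denominator of the row. *)
Lemma det_psi_hooks n lam : row_shape m n lam ->
  \det (psi_mx lam) * \prod_(i < m) \prod_(c < lam i) (1 - q ^+ row_hook lam i c)
  = (\prod_(j < m) q ^+ j) * q ^+ (\sum_(i < m) i * (m - i.+1))
    * q ^+ (\sum_(i < m) i * lam i).
Proof.
move=> shp; rewrite det_psi_mx -!mulrA; congr (_ * _).
have -> : \det (vdm_mx lam) =
    (\prod_(i < m) \prod_(i.+1 <= j < m) q ^+ (beta_number lam j).-1)
    * \prod_(i < m) \prod_(i.+1 <= j < m)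
        (1 - q ^+ ((beta_number lam i).-1 - (beta_number lam j).-1)).
  have -> : vdm_mx lam = (Vandermonde m (\row_i q ^+ (beta_number lam i).-1))^T.
    by apply/matrixP => i j; rewrite !mxE.
  rewrite det_tr det_Vandermonde -big_split; apply: eq_bigr => i _; rewrite -big_split.
  rewrite (big_nat_widenl _ 0%N) // big_mkord; apply: eq_bigr => j ij.
  rewrite !mxE /= mulrBr mulr1 -exprD subnKC //.
  by have := row_shape_homo shp (ltnW ij); rewrite /beta_number; clear shp; lia.
rewrite mulrCA -!mulrA -exprD -(sum_beta_number_above shp).
rewrite -[RHS]mulr1; congr (_ * _).
  by rewrite expr_sum; apply: eq_bigr => i _; rewrite expr_sum.
rewrite -!big_split /= big1 // => i _.
have /= row := prod_row_hooks (fun k => 1 - q ^+ k) shp (ltn_ord i).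
by rewrite mulrC -mulrA row mulVf // qfact_neq0.
Qed.

(** Comparing [det_psi_hooks] for [lam] and for the empty shape, which has no hooks, eliminates the
    common power [K] of q. *)
Lemma lattice_words_hook n lam : row_shape m n lam ->
  (\sum_(w <- lattice_words m n lam) q ^+ word_maj w)
    * \prod_(i < m) \prod_(c < lam i) (1 - q ^+ row_hook lam i c)
  = q ^+ (\sum_(i < m) i * lam i) * qfact n.
Proof.
move=> shp; have shp0 : row_shape m 0 (fun=> 0%N) by split; rewrite ?big1.
have := wgf_det shp (leq0n m).
rewrite !(det_strip0 shp, det_strip0 shp0) /wgf.
under eq_bigr => w _ do rewrite ltn0 mulr1.
set W := \sum_(w <- _) _; set H := \prod_(i < m) _.
have := det_psi_hooks shp; have := det_psi_hooks shp0; rewrite -/H.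
rewrite (big1 _ _ (fun i : 'I_m => i * 0)%N) => [|i _]; last by rewrite muln0.
rewrite [in X in X -> _](big1 (op := *%R)) => [|i _]; last by rewrite big_ord0.
rewrite expr0 !mulr1; set K := _ * _ => -> detH detE.
have K0 : K != 0.
  by rewrite mulf_neq0 ?expf_neq0 //; apply/prodf_neq0 => j _; rewrite expf_neq0.
apply: (mulfI K0); rewrite [RHS]mulrA -detH -detE.
by have := qfact_neq0 n => nz; field.
Qed.

End Determinant.

(** * Lattice words in terms of prefix counts *)

Lemma count_take (s : seq nat) (a : pred nat) k :
  count a (take k s) = (\sum_(0 <= j < size s | j < k) a (nth 0 s j))%N.
Proof.
elim: s k => [|x s IHs] [|k] /=.
- by rewrite big_geq.
- by rewrite big_geq.
- by rewrite big_pred0.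
rewrite IHs big_mkcond [RHS]big_mkcond big_nat_recl //=.
Qed.

Lemma count_take_mono (s : seq nat) (a : pred nat) k k' :
  (k <= k')%N -> (count a (take k s) <= count a (take k' s))%N.
Proof.
move=> kk'; rewrite !count_take big_mkcond [leqRHS]big_mkcond.
by apply: leq_sum => j _; case: ltnP => // /leq_trans ->.
Qed.

(** Induction on the last letter [r]. The prefix inequality for the whole word is the monotonicity
    of [lam]; for the word without its last letter it says that row [r] ends in a corner. *)
Lemma mem_lattice_words m n lam w : row_shape m n lam ->
  (w \in lattice_words m n lam) <->
  [/\ size w = n, forall r, count_mem r w = lam r
    & forall k r, (count_mem r.+1 (take k w) <= count_mem r (take k w))%N].
Proof.
elim: n lam w => [|n IHn] lam w shp.
  have lam0 i : lam i = 0%N.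
    have [_ lamm /eqP] := shp; rewrite big_mkord sum_nat_eq0 => /forallP h.
    case: (ltnP i m) => im; first by have /eqP := h (Ordinal im).
    by have := row_shape_homo shp im; rewrite lamm leqn0 => /eqP.
  rewrite inE; split=> [/eqP -> | [/size0nil -> //]].
  by split.
have lam_gt r : (0 < lam r)%N -> (r < m)%N.
  have [_ lamm _] := shp; case: (ltnP r m) => // /(row_shape_homo shp).
  by rewrite lamm; lia.
split=> [/flatten_mapP[r] | [sw cw lw]].
  rewrite mem_filter mem_iota => /and3P[lt_r _ rm] /mapP[w' + ->].
  have shp' := row_shape_dec shp rm lt_r.
  move/(IHn _ _ shp') => [sw cw lw].
  have cr x : count_mem x (rcons w' r) = lam x.
    rewrite -cats1 count_cat /= cw addn0 /dec_row [r == x]eq_sym subnK //.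
    by case: eqVneq => // ->; apply: leq_ltn_trans lt_r.
  split=> [|//|k x]; first by rewrite size_rcons sw.
  case: (leqP k (size w')) => kw; last first.
    by rewrite take_oversize ?size_rcons // !cr; have [] := shp.
  by rewrite -cats1 takel_cat.
case/lastP: w => [//|w' r] in sw cw lw *.
move: sw; rewrite size_rcons => -[sw].
have cw' x : count_mem x w' = dec_row lam r x.
  by rewrite /dec_row -cw -cats1 count_cat /= addn0 [r == x]eq_sym addnK.
have lamr : (0 < lam r)%N by rewrite -cw -cats1 count_cat /= eqxx; lia.
have lt_r : (lam r.+1 < lam r)%N.
  have := lw (size w') r; rewrite -cats1 take_size_cat // !cw' /dec_row eqxx.
  by rewrite gtn_eqF //; clear -lamr; lia.
have rm := lam_gt _ lamr.
apply/flatten_mapP; exists r; first by rewrite mem_filter lt_r mem_iota rm.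
apply: map_f; apply/(IHn _ _ (row_shape_dec shp rm lt_r)); split=> // k x.
case: (leqP k (size w')) => kw; first by have := lw k x; rewrite -cats1 takel_cat.
by have := lw (size w') x; rewrite -cats1 take_size_cat // take_oversize // ltnW.
Qed.

Lemma uniq_lattice_words m n lam : uniq (lattice_words m n lam).
Proof.
elim: n lam => [//|n IHn] lam; rewrite /=.
apply: (@allpairs_uniq_dep _ (fun=> seq nat) _ (fun r w => rcons w r)).
- by rewrite filter_uniq ?iota_uniq.
- by move=> r _; apply: IHn.
move=> [r w] [r' w'] _ _ /= /rcons_inj [-> ->] //.
Qed.

(** * Standard tableaux and their row words *)

Section Tableaux.

Variables (n : nat) (lam : seq nat).
Hypothesis lamP : is_partition n lam.

Local Notation m := (size lam).
Local Notation L := (nth 0%N lam).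

Lemma partition_row_shape : row_shape m n L.
Proof.
have /and3P[lam_sorted _ /eqP lam_sum] := lamP; split.
- move=> i; case: (ltnP i.+1 m) => im; last by rewrite nth_default.
  by have /(sortedP 0%N) := lam_sorted; apply.
- by rewrite nth_default.
- by rewrite -lam_sum sumnE [RHS](big_nth 0%N).
Qed.

Lemma row_gt0_lt r c : (c < L r)%N -> (r < m)%N.
Proof. by case: (ltnP r m) => // rm; rewrite nth_default. Qed.

Lemma cell_row_lt (c : cell lam) : (cell_row c < m)%N.
Proof. exact: ltn_ord. Qed.

Lemma cell_col_lt (c : cell lam) : (cell_col c < L (cell_row c))%N.
Proof. exact: ltn_ord. Qed.

Lemma cell_ext (c c' : cell lam) :
  cell_row c = cell_row c' -> cell_col c = cell_col c' -> c = c'.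
Proof.
case: c c' => [i j] [i' j']; rewrite /cell_row /cell_col /= => /val_inj ii'.
by case: i' / ii' in j' * => /val_inj ->.
Qed.

Lemma cell_ex r k : (k < L r)%N ->
  {c : cell lam | cell_row c = r & cell_col c = k}.
Proof.
move=> kr; pose i := Ordinal (row_gt0_lt kr).
by exists (Tagged (fun i : 'I_m => 'I_(L i)) (Ordinal kr : 'I_(L i))).
Qed.

Lemma big_cell (V : Type) (idx : V) (op : Monoid.com_law idx)
    (f : nat -> nat -> V) :
  \big[op/idx]_(c : cell lam) f (cell_row c) (cell_col c)
  = \big[op/idx]_(i < m) \big[op/idx]_(j < L i) f i j.
Proof.
exact: esym (@sig_big_dep _ idx op _ (fun i : 'I_m => 'I_(L i)) xpredT
  (fun _ => xpredT) (fun i j => f i j)).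
Qed.

Lemma card_cell : #|{: cell lam}| = n.
Proof.
rewrite -sum1_card (big_cell _ (fun _ _ => 1%N)).
have [_ _ <-] := partition_row_shape; rewrite big_mkord.
by apply: eq_bigr => i _; rewrite sum1_card card_ord.
Qed.

Lemma card_row_lt r k : (k <= L r)%N ->
  #|[set c : cell lam | (cell_row c == r) && (cell_col c < k)%N]| = k.
Proof.
move=> kr; rewrite cardsE -sum1_card big_mkcond /=.
rewrite (big_cell _ (fun i j => if (i == r) && (j < k)%N then 1%N else 0%N)).
case: (ltnP r m) => rm.
  rewrite (bigD1 (Ordinal rm)) //= [X in (_ + X)%N]big1 ?addn0 => [|i]; last first.
    by rewrite -val_eqE /= => /negPf ->; rewrite big1.
  rewrite eqxx -big_mkcond -(big_ord_widen _ (fun=> 1%N)) // sum1_card card_ord //.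
rewrite nth_default // leqn0 in kr; move/eqP: kr => ->.
by rewrite big1 // => i _; rewrite big1 // => j _; rewrite andbF.
Qed.

Lemma hook_length_row_hook (c : cell lam) :
  hook_length c = row_hook m L (cell_row c) (cell_col c).
Proof.
have := cell_row_lt c; have := cell_col_lt c; rewrite /hook_length /row_hook.
move: (cell_row c) (cell_col c) => i j ji im.
rewrite cardsE -sum1_card big_mkcond /=.
pose p i' j' := (i' == i) && (j <= j')%N || (j' == j) && (i <= i')%N.
rewrite (big_cell _ (fun i' j' => if p i' j' then 1%N else 0%N)).
rewrite -(big_mkord xpredT (fun i' => \sum_(j' < L i') (if p i' j' then 1 else 0))%N).
rewrite (big_cat_nat (n := i)) //=; last exact: ltnW.
rewrite big_nat_cond big1 ?add0n => [|i' /andP[/andP[_ i'i] _]]; last first.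
  by rewrite big1 // => j' _; rewrite /p (ltn_eqF i'i) [(i <= i')%N]leqNgt i'i andbF.
rewrite big_ltn //; congr (_ + _)%N.
  rewrite -(big_mkord xpredT (fun j' => if p i j' then 1 else 0)%N).
  rewrite (big_cat_nat (n := j)) //=; last exact: ltnW.
  rewrite big_nat_cond big1 ?add0n => [|j' /andP[/andP[_ j'j] _]]; last first.
    by rewrite /p eqxx leqNgt j'j (ltn_eqF j'j).
  rewrite big_nat_cond (eq_bigr (fun=> 1%N)) => [|j' /andP[/andP[jj' _] _]]; last first.
    by rewrite /p eqxx jj'.
  by rewrite -big_nat_cond sum_nat_const_nat muln1.
rewrite big_nat_cond [RHS]big_nat_cond; apply: eq_bigr => i' /andP[/andP[ii' _] _].
rewrite /p gtn_eqF //= (ltnW ii') -big_mkcond /=.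
under eq_bigl => j' do rewrite andbT.
case: (ltnP j (L i')) => ji'.
  by rewrite (big_pred1 (Ordinal ji')).
by rewrite big_pred0 // => j'; rewrite ltn_eqF // (leq_trans (ltn_ord j')).
Qed.

Lemma prod_hook_length (K : comPzRingType) (f : nat -> K) :
  \prod_(c : cell lam) f (hook_length c)
  = \prod_(i < m) \prod_(j < L i) f (row_hook m L i j).
Proof.
rewrite -(big_cell _ (fun i j => f (row_hook m L i j))).
by apply: eq_bigr => c _; rewrite hook_length_row_hook.
Qed.

Lemma syt_inj (T : syt n lam) : injective (val T).
Proof. by apply/injectiveP; have /and4P[] := valP T. Qed.

Lemma syt_surj (T : syt n lam) k : exists c, val T c == k.
Proof. by have /and4P[_ /forallP/(_ k)/existsP] := valP T. Qed.

Definition cell_at (T : syt n lam) (k : 'I_n) : cell lam :=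
  xchoose (syt_surj T k).

Lemma cell_atK (T : syt n lam) : cancel (cell_at T) (val T).
Proof. by move=> k; apply/eqP/(xchooseP (syt_surj T k)). Qed.

Lemma entry_cellK (T : syt n lam) : cancel (val T) (cell_at T).
Proof. by move=> c; apply: (@syt_inj T); rewrite cell_atK. Qed.

Lemma syt_row_lt (T : syt n lam) (c c' : cell lam) : cell_row c = cell_row c' ->
  ((val T c < val T c') = (cell_col c < cell_col c'))%N.
Proof.
have /and4P[_ _ /'forall_forallP rowT _] := valP T.
have lt a b : cell_row a = cell_row b -> (cell_col a < cell_col b)%N ->
    (val T a < val T b)%N.
  by move=> ab cab; have /implyP := rowT a b; apply; rewrite ab eqxx.
move=> cc'; case: (ltngtP (cell_col c) (cell_col c')) => h; first exact: lt.
  by apply/negbTE; rewrite -leqNgt ltnW // lt.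
by rewrite (cell_ext cc' h) ltnn.
Qed.

Lemma syt_col_lt (T : syt n lam) (c c' : cell lam) : cell_col c = cell_col c' ->
  (cell_row c < cell_row c')%N -> (val T c < val T c')%N.
Proof.
have /and4P[_ _ _ /'forall_forallP colT] := valP T.
by move=> cc' rcc'; have /implyP := colT c c'; apply; rewrite cc' eqxx.
Qed.

(** The Yamanouchi word of the tableau, with rows numbered from 0. *)
Definition row_word (T : syt n lam) : seq nat :=
  [seq cell_row (cell_at T k) | k <- enum 'I_n].

Lemma size_row_word (T : syt n lam) : size (row_word T) = n.
Proof. by rewrite size_map size_enum_ord. Qed.

Lemma nth_row_word (T : syt n lam) (k : 'I_n) :
  nth 0%N (row_word T) k = cell_row (cell_at T k).
Proof. by rewrite (nth_map k) ?size_enum_ord // nth_ord_enum. Qed.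

Lemma count_row_word (T : syt n lam) r k : count_mem r (take k (row_word T))
  = #|[set c : cell lam | (cell_row c == r) && (val T c < k)%N]|.
Proof.
rewrite count_take size_row_word big_mkcond big_mkord cardsE -sum1_card.
rewrite [RHS]big_mkcond /= (reindex (val T)) /=; last first.
  by exists (cell_at T) => c _; rewrite ?entry_cellK ?cell_atK.
apply: eq_bigr => c _; rewrite nth_row_word entry_cellK.
by rewrite -[_ \in _]/(_ && _); case: eqP; case: ltnP.
Qed.

(** In a row, the entries smaller than that of [c] are those to its left. So the word determines the
    column of each entry, which gives [row_word_inj] and dictates the inverse in [row_word_surj]. *)
Lemma count_row_word_entry (T : syt n lam) (c : cell lam) :
  count_mem (cell_row c) (take (val T c) (row_word T)) = cell_col c.
Proof.
rewrite count_row_word -[RHS](@card_row_lt (cell_row c)) ?(ltnW (cell_col_lt c)) //.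
apply: eq_card => c'; rewrite !inE.
by case: eqVneq => //= cc'; rewrite (syt_row_lt _ cc').
Qed.

Lemma row_word_lattice (T : syt n lam) : row_word T \in lattice_words m n L.
Proof.
apply/(mem_lattice_words _ partition_row_shape); split=> [|r|k r].
- exact: size_row_word.
- rewrite -[row_word T](@take_size) count_row_word size_row_word.
  rewrite -[RHS](@card_row_lt r) //; apply: eq_card => c; rewrite !inE ltn_ord.
  by case: eqVneq => //= <-; rewrite cell_col_lt.
(* Moving the cells of row [r.+1] one row up is injective and lowers their entries; this gives the
   prefix inequality. *)
have up_ex (c : cell lam) : exists c' : cell lam, (cell_row c == r.+1) ==>
    (cell_row c' == r) && (cell_col c' == cell_col c).
  case: (eqVneq (cell_row c) r.+1) => cr; last by exists c.
  have lt_c : (cell_col c < L r)%N.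
    apply: leq_trans (cell_col_lt c) _; rewrite cr.
    by have [] := partition_row_shape.
  by have [c' rc' cc'] := cell_ex lt_c; exists c'; rewrite rc' cc' !eqxx.
pose up c := xchoose (up_ex c).
have upP c : cell_row c = r.+1 -> cell_row (up c) = r /\ cell_col (up c) = cell_col c.
  by move/eqP=> cr; have /implyP/(_ cr)/andP[/eqP ? /eqP ?] := xchooseP (up_ex c).
rewrite !count_row_word -(@card_in_imset _ _ up) => [|c c']; last first.
  rewrite !inE => /andP[/eqP cr _] /andP[/eqP cr' _] eq_up.
  apply: cell_ext; first by rewrite cr cr'.
  by have [_ <-] := upP c cr; have [_ <-] := upP c' cr'; rewrite eq_up.
apply: subset_leq_card; apply/fintype.subsetP => _ /imsetP[c + ->].
rewrite !inE => /andP[/eqP cr ck]; have [ur uc] := upP c cr.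
rewrite ur eqxx; apply: ltn_trans ck.
by apply: syt_col_lt => //; rewrite ur cr.
Qed.

Lemma row_word_inj : injective row_word.
Proof.
move=> T1 T2 eq_w; apply/val_inj/ffunP => c; apply: (can_inj (cell_atK T2)).
rewrite entry_cellK.
have eq_r : cell_row (cell_at T2 (val T1 c)) = cell_row c.
  by rewrite -nth_row_word -eq_w nth_row_word entry_cellK.
apply: cell_ext => //.
by rewrite -(count_row_word_entry T2) eq_r cell_atK -eq_w count_row_word_entry.
Qed.

Lemma row_word_surj w : w \in lattice_words m n L -> exists T, row_word T = w.
Proof.
move/(mem_lattice_words _ partition_row_shape) => [sw cw lw].
(* The entry [k] goes to row [w_k], after the earlier occurrences of [w_k]. *)
have cellP (k : 'I_n) : exists c : cell lam, (cell_row c == nth 0%N w k)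
    && (cell_col c == count_mem (nth 0%N w k) (take k w)).
  have kw : (k < size w)%N by rewrite sw.
  have lt_k : (count_mem (nth 0%N w k) (take k w) < L (nth 0%N w k))%N.
    rewrite -cw -[X in (_ < count_mem _ X)%N](cat_take_drop k w) count_cat.
    by rewrite (drop_nth 0%N kw) /= eqxx; lia.
  by have [c rc cc] := cell_ex lt_k; exists c; rewrite rc cc !eqxx.
pose f k := xchoose (cellP k).
have f_row k : cell_row (f k) = nth 0%N w k.
  by have /andP[/eqP] := xchooseP (cellP k).
have f_col k : cell_col (f k) = count_mem (cell_row (f k)) (take k w).
  by rewrite f_row; have /andP[_ /eqP] := xchooseP (cellP k).
have lt_col (k k' : 'I_n) : cell_row (f k) = cell_row (f k') -> (k < k')%N ->
    (cell_col (f k) < cell_col (f k'))%N.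
  move=> rkk' kk'; rewrite !f_col -rkk'.
  apply: leq_trans (count_take_mono _ _ kk').
  by rewrite (take_nth 0%N) ?sw // -cats1 count_cat /= f_row eqxx addn1.
have f_inj : injective f.
  move=> k k' eq_f; apply/val_inj; case: (ltngtP k k') => // /lt_col;
    by rewrite eq_f ltnn => /(_ erefl).
have [g fK gK] : bijective f by apply: inj_card_bij; rewrite ?card_cell ?card_ord.
pose T := [ffun c => g c].
have TP : is_syt T.
  apply/and4P; split.
  - by apply/injectiveP => c c'; rewrite !ffunE; apply: can_inj gK c c'.
  - by apply/forallP => k; apply/existsP; exists (f k); rewrite ffunE fK.
  - apply/'forall_forallP => c c'; apply/implyP => /andP[/eqP rcc' ccc'].
    rewrite !ffunE; case: (ltngtP (g c) (g c')) => // [/lt_col|/val_inj].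
      by rewrite !gK => /(_ (esym rcc')); case: ltngtP ccc'.
    by move/(can_inj gK) => eq_c; rewrite eq_c ltnn in ccc'.
  (* If the lower cell [c'] were filled first, the prefix ending with its letter would contain that
     letter [cell_col c + 1] times, but the letter of [c] at most [cell_col c] times. *)
  apply/'forall_forallP => c c'; apply/implyP => /andP[/eqP ccc' rcc'].
  rewrite !ffunE ltnNge; apply/negP => le_g.
  have := f_col (g c); have := f_col (g c'); rewrite !gK -ccc' => c'E cE.
  have lat r r' k : (r <= r')%N ->
      (count_mem r' (take k w) <= count_mem r (take k w))%N.
    move/subnKC <-; elim: (r' - r)%N => [|d IHd]; first by rewrite addn0.
    by rewrite addnS; apply: leq_trans (lw _ _) IHd.
  have lt_g : (g c' < g c)%N.
    rewrite ltn_neqAle le_g andbT; apply: contraTneq rcc' => /val_inj /(can_inj gK) ->.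
    by rewrite ltnn.
  have := lat _ _ (g c').+1 (ltnW rcc').
  rewrite (take_nth 0%N) ?sw // -cats1 !count_cat -f_row gK /= eqxx -c'E.
  rewrite (gtn_eqF rcc') !addn0 addn1.
  have := @count_take_mono w (pred1 (cell_row c)) _ _ le_g; rewrite -cE.
  by move=> h1 h2; have := leq_trans h2 h1; rewrite ltnn.
exists (Sub T TP); apply: (@eq_from_nth _ 0%N); rewrite size_row_word ?sw // => k kn.
rewrite (nth_row_word _ (Ordinal kn)) -(f_row (Ordinal kn)); congr cell_row.
by rewrite -[RHS](entry_cellK (Sub T TP)) /= ffunE fK.
Qed.

Lemma maj_row_word (T : syt n lam) : maj T = word_maj (row_word T).
Proof.
rewrite /maj /word_maj size_row_word big_nat_cond [RHS]big_nat_cond.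
apply: eq_bigl => i; case: (boolP (1 <= i < n)%N) => //= /andP[i_gt0 i_n].
have i'_n : (i.-1 < n)%N by rewrite (leq_ltn_trans (leq_pred i)).
rewrite (nth_row_word _ (Ordinal i'_n)) (nth_row_word _ (Ordinal i_n)).
apply/existsP/idP => [[c /existsP[c' /and3P[/eqP ci /eqP c'i cc']]]|lt_r].
  have <- : val T c = Ordinal i'_n by apply: val_inj; rewrite /= -ci.
  have <- : val T c' = Ordinal i_n by apply: val_inj; case: c'i.
  by rewrite !entry_cellK.
exists (cell_at T (Ordinal i'_n)); apply/existsP.
exists (cell_at T (Ordinal i_n)).
by rewrite lt_r /entry !cell_atK /= prednK // !eqxx.
Qed.

Lemma sum_syt_maj (V : nmodType) (f : nat -> V) :
  \sum_(T : syt n lam) f (maj T) = \sum_(w <- lattice_words m n L) f (word_maj w).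
Proof.
have eq_w : perm_eq [seq row_word T | T : syt n lam] (lattice_words m n L).
  apply: uniq_perm.
  - by rewrite map_inj_uniq ?enum_uniq //; apply: row_word_inj.
  - exact: uniq_lattice_words.
  move=> w; apply/mapP/idP => [[T _ ->]|]; first exact: row_word_lattice.
  by case/row_word_surj => T <-; exists T; rewrite ?mem_enum.
rewrite -(perm_big _ eq_w) big_map big_enum /=.
by apply: eq_bigr => T _; rewrite maj_row_word.
Qed.

Lemma sum_syt_hook (F : fieldType) (q : F) :
  (forall k, q ^+ k.+1 != 1) -> q != 0 ->
  (\sum_(T : syt n lam) q ^+ maj T)
    * \prod_(c : cell lam) (1 - q ^+ hook_length c)
  = q ^+ (\sum_(i < m) i * L i) * \prod_(k < n) (1 - q ^+ k.+1).
Proof.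
move=> q1 q0; rewrite (sum_syt_maj (fun k => q ^+ k)).
rewrite (prod_hook_length (fun k => 1 - q ^+ k)).
exact: (lattice_words_hook q1 q0 partition_row_shape).
Qed.

End Tableaux.

Local Open Scope classical_set_scope.

(** * The series of x / (1 - e^(-x)) and of log((e^x - 1) / x) *)

Section BernoulliSeries.

Variable R : realType.
Implicit Types (c : nat -> R) (x t : R).

(** The coefficients of (1 - e^(-x)) / x. *)
Definition todd_den k : R := (-1) ^+ k / k.+1`!%:R.

(** Each coefficient of the reciprocal series depends on all earlier ones, so the recursion carries
    the list of them. The coefficients turn out to be B_k / k!. *)
Fixpoint todd_prefix n : seq R :=
  if n is n'.+1 then
    let s := todd_prefix n' in
    rcons s ((n' == 0%N)%:R - \sum_(k < n') todd_den (n' - k) * s`_k)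
  else [::].

Definition todd_coef n : R :=
  (n == 0%N)%:R - \sum_(k < n) todd_den (n - k) * (todd_prefix n)`_k.

Lemma todd_prefixE n : todd_prefix n = mkseq todd_coef n.
Proof. by elim: n => // n IHn; rewrite mkseqS -IHn. Qed.

Lemma todd_coefE n :
  todd_coef n = (n == 0%N)%:R - \sum_(k < n) todd_den (n - k) * todd_coef k.
Proof.
rewrite {1}/todd_coef todd_prefixE; congr (_ - _).
by apply: eq_bigr => k _; rewrite nth_mkseq.
Qed.

Lemma todd_den0 : todd_den 0 = 1.
Proof. by rewrite /todd_den expr0 factS fact0 divr1. Qed.

Lemma todd_conv n :
  \sum_(k < n.+1) todd_den (n - k) * todd_coef k = (n == 0%N)%:R.
Proof. by rewrite big_ord_recr /= subnn todd_den0 mul1r todd_coefE addrC subrK. Qed.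

Lemma todd_den_le k : `|todd_den k| <= 2^-1 ^+ k.
Proof.
rewrite normrM normrX normrN1 expr1n mul1r normfV exprVn.
rewrite ger0_norm ?ler0n // lef_pV2 ?posrE ?exprn_gt0 ?ltr0n ?fact_gt0 //.
rewrite -natrX ler_nat; elim: k => // k IHk.
by rewrite expnS factS leq_mul.
Qed.

(** Strong induction: by [todd_den_le] the convolution is at most 1/2 + 1/4 + ... + 1/2^n <= 1. *)
Lemma todd_coef_le n : `|todd_coef n| <= 1.
Proof.
elim/ltn_ind: n => n IHn; rewrite todd_coefE.
case: n IHn => [|n] IHn; first by rewrite big_ord0 subr0 normr1.
rewrite sub0r normrN; apply: le_trans (ler_norm_sum _ _ _) _.
apply: (@le_trans _ _ (\sum_(k < n.+1) 2^-1 ^+ (n.+1 - k))).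
  apply: ler_sum => k _; rewrite normrM -[leRHS]mulr1.
  by apply: ler_pM => //; [apply: todd_den_le | apply: IHn].
rewrite (reindex_inj rev_ord_inj) /=.
under eq_bigr => k _ do rewrite subSS (subSn (leq_subr _ _)) (subKn (leq_ord k)).
elim: {IHn}n => [|n IHn].
  by rewrite big_ord1; lra.
rewrite big_ord_recl /=.
under eq_bigr => k _ do rewrite /bump /= add1n exprS.
by rewrite -mulr_sumr; lra.
Qed.

Lemma cvg_pseries_geo c C x : (forall n, `|c n| <= C * 4 ^+ n) -> `|x| < 4^-1 ->
  cvgn (pseries c x).
Proof.
move=> c_le x_lt; apply: normed_cvg.
have x4 : `| `|4 * x| | < 1 by rewrite normr_id normrM ger0_norm //; lra.
have C0 : 0 <= C by have := c_le 0%N; rewrite expr0 mulr1; apply: le_trans.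
apply: (@series_le_cvg _ _ (geometric C `|4 * x|)) => [n|n|n|] /=.
- by [].
- by rewrite mulr_ge0 ?exprn_ge0.
- rewrite !normrM normrX exprMn [`|4|]ger0_norm // mulrA.
  by rewrite ler_wpM2r ?exprn_ge0.
- exact: is_cvg_geometric_series.
Qed.

(** Termwise differentiation uses convergence of the series and of its first two formal derivatives
    at a point beyond [x], here 1/8. The second derivative brings in (n + 1)(n + 2) <= 2 * 4^n,
    which the radius 1/4 of [cvg_pseries_geo] absorbs. *)
Lemma is_derive_pseries_geo c C x : (forall n, `|c n| <= C) -> `|x| < 8^-1 ->
  is_derive x 1 (fun y => limn (pseries c y)) (limn (pseries (pseries_diffs c) x)).
Proof.
move=> c_le x_lt.
have C0 : 0 <= C by apply: le_trans (c_le 0%N).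
have n_le n : n.+1%:R <= 2 ^+ n :> R.
  by rewrite -natrX ler_nat; elim: n => // n IHn; rewrite expnS; lia.
have n4_le n : n.+1%:R * n.+2%:R <= 2 * 4 ^+ n :> R.
  rewrite (_ : 4 = 2 * 2); last by ring.
  rewrite exprMn mulrCA -exprS -[leLHS]mulrC mulrC.
  by apply: ler_pM => //; apply: (n_le n.+1).
have K8 : `|8^-1 : R| < 4^-1 by rewrite ger0_norm //; lra.
have x8 : `|x| < `|8^-1 : R| by rewrite [ltRHS]ger0_norm.
have pow4_ge1 n : 1 <= 4 ^+ n :> R by rewrite exprn_ege1 // ler1n.
apply: (@pseries_snd_diffs _ _ (8^-1)) => //.
- apply: (@cvg_pseries_geo _ C) K8 => n.
  by apply: le_trans (c_le n) _; rewrite ler_peMr.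
- apply: (@cvg_pseries_geo _ (2 * C)) K8 => n.
  rewrite /pseries_diffs normrM normr_nat mulrC [2 * C]mulrC -mulrA.
  apply: ler_pM => //; apply: le_trans (n4_le n).
  by rewrite ler_peMr // ler1n.
- apply: (@cvg_pseries_geo _ (2 * C)) K8 => n.
  rewrite /pseries_diffs !normrM !normr_nat mulrA mulrC [2 * C]mulrC -mulrA.
  by apply: ler_pM.
Qed.

Definition todd x : R := limn (pseries todd_coef x).

Lemma cvg_todd x : `|x| < 4^-1 -> pseries todd_coef x @ \oo --> todd x.
Proof.
apply: (@cvg_pseries_geo _ 1) => n; apply: le_trans (todd_coef_le n) _.
by rewrite mul1r exprn_ege1 // ler1n.
Qed.

(* By [todd_conv] the product of the two truncations has no monomial of degree
   1, ..., N - 1. *)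
Lemma todd_partial_prod_le N x : (0 < N)%N -> `|x| < 1 ->
  `| (\sum_(i < N) todd_den i * x ^+ i) * (\sum_(i < N) todd_coef i * x ^+ i) - 1|
  <= 2 * `|4 * x| ^+ N.
Proof.
move=> N_gt0 x_lt.
pose A : {poly R} := \poly_(i < N) todd_den i.
pose B : {poly R} := \poly_(i < N) todd_coef i.
rewrite -!horner_poly -/A -/B -hornerM.
have szAB : (size (A * B)%R <= N + N)%N.
  apply: leq_trans (size_polyMleq _ _) _.
  by have := size_poly N todd_den; have := size_poly N todd_coef; rewrite -/A -/B; lia.
have coefs n : (A * B)%R`_n = \sum_(i < n.+1) A`_(n - i) * B`_i by rewrite coefMr.
have lowc n : (n < N)%N -> (A * B)%R`_n = (n == 0%N)%:R.
  move=> nN; rewrite coefs -todd_conv; apply: eq_bigr => i _.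
  rewrite !coef_poly (leq_ltn_trans (leq_subr _ _) nN).
  by rewrite (leq_ltn_trans _ nN) // -ltnS.
have A_le i : `|A`_i| <= 1.
  rewrite coef_poly; case: ifP => _; last by rewrite normr0.
  by apply: le_trans (todd_den_le i) _; rewrite exprn_ile1 //; lra.
have B_le i : `|B`_i| <= 1.
  by rewrite coef_poly; case: ifP => _; rewrite ?normr0 ?todd_coef_le.
have highc n : (n < N + N)%N -> `|(A * B)%R`_n| <= (N + N)%:R.
  move=> nN; rewrite coefs; apply: le_trans (ler_norm_sum _ _ _) _.
  apply: (@le_trans _ _ (\sum_(i < n.+1) 1)).
    by apply: ler_sum => i _; rewrite normrM mulr_ile1.
  by rewrite sumr_const card_ord ler_nat.
rewrite (horner_coef_wide _ szAB) -(big_mkord xpredT (fun i => (A * B)%R`_i * x ^+ i)).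
rewrite (big_cat_nat (n := N)) ?leq_addr //=.
have -> : \sum_(0 <= i < N) (A * B)%R`_i * x ^+ i = 1.
  rewrite big_ltn // lowc // expr0 mulr1 big_nat_cond big1 ?addr0 // => i.
  by case/andP => /andP[i_gt0 iN] _; rewrite lowc // gtn_eqF // mul0r.
rewrite addrAC subrr add0r; apply: le_trans (ler_norm_sum _ _ _) _.
(* There are N terms of high degree with coefficients at most 2 N, and N^2 <= 4^N. *)
apply: (@le_trans _ _ (\sum_(N <= i < N + N) (N + N)%:R * `|x| ^+ N)).
  apply: ler_sum_nat => i /andP[Ni iN]; rewrite normrM normrX.
  by apply: ler_pM => //; [apply: highc | rewrite ler_wiXn2l // ltW].
rewrite sumr_const_nat addnK -mulrnAl normrM exprMn mulrA.
rewrite ler_wpM2r ?exprn_ge0 // ger0_norm // -natrX -natrM -mulrnA ler_nat.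
have : (N < 2 ^ N)%N by rewrite ltn_expl.
by rewrite (_ : 4 = 2 * 2)%N // expnMn; nia.
Qed.

Lemma todd_den_partial N x :
  series (exp_coeff (- x)) N.+1 = 1 - x * \sum_(i < N) todd_den i * x ^+ i.
Proof.
rewrite /series /= big_mkord big_ord_recl /= /exp_coeff /= expr0 fact0 divr1.
congr (_ + _); rewrite mulr_sumr -sumrN; apply: eq_bigr => i _.
by rewrite /bump /= add1n exprNn /todd_den !exprS; ring.
Qed.

(** With A and B the partial sums of the two series, x A tends to 1 - e^(-x) and A B to 1, so x A B
    has the limits of both sides. *)
Lemma todd_mul x : `|x| < 4^-1 -> todd x * (1 - expR (- x)) = x.
Proof.
move=> x_lt; have x4 : `| `|4 * x| | < 1.
  by rewrite normr_id normrM ger0_norm //; lra.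
pose A N := \sum_(i < N) todd_den i * x ^+ i.
pose B N := \sum_(i < N) todd_coef i * x ^+ i.
have cvB : B @ \oo --> todd x.
  rewrite (_ : B = pseries todd_coef x); first exact: cvg_todd.
  by apply/funext => N; rewrite /B /pseries /series /= big_mkord.
have cvA : (fun N => x * A N) @ \oo --> 1 - expR (- x).
  have -> : (fun N => x * A N) = (fun N => 1 - series (exp_coeff (- x)) N.+1).
    by apply/funext => N; rewrite todd_den_partial /A; ring.
  apply: cvgB; first exact: cvg_cst.
  by rewrite (cvg_shiftS (series (exp_coeff (- x)))); apply: is_cvg_series_exp_coeff.
have cvAB : (fun N => A N * B N - 1) @ \oo --> (0 : R).
  apply/norm_cvg0P; apply: (@squeeze_cvgr _ _ _ _ (fun=> 0) (geometric 2 `|4 * x|)).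
  - near=> N; rewrite normr_ge0 /=; apply: todd_partial_prod_le.
      by near: N; exists 1%N.
    by apply: lt_trans x_lt _; lra.
  - exact: cvg_cst.
  - exact: cvg_geometric.
have cvx : (fun N => x * A N * B N) @ \oo --> x.
  have -> : (fun N => x * A N * B N) = (fun N => x * (A N * B N - 1) + x).
    by apply/funext => N; ring.
  rewrite -[X in _ --> X]add0r -[X in _ --> X + _](mulr0 x).
  by apply: cvgD; [apply: cvgM => //; apply: cvg_cst | apply: cvg_cst].
apply: (cvg_unique _ _ cvx) => //.
by rewrite mulrC; apply: cvgM.
Unshelve. all: by end_near.
Qed.

Lemma todd0 : todd 0 = 1.
Proof.
have cv : pseries todd_coef 0 @ \oo --> todd 0.
  by apply: cvg_todd; rewrite normr0.
apply: (cvg_unique _ cv) => //.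
rewrite /= -(cvg_shiftS (pseries todd_coef 0)).
rewrite [X in X @ _ --> _](_ : _ = fun=> 1); first exact: cvg_cst.
apply/funext => N; rewrite /pseries /series /= big_nat_recl // expr0 mulr1.
rewrite todd_coefE big_ord0 subr0 big1 ?addr0 // => i _.
by rewrite exprS mul0r mulr0.
Qed.

(* The coefficient at [k = 0] is 0 since division by 0 gives 0. *)
Definition log_todd_coef k : R := todd_coef k / k%:R.

Definition log_todd x : R := limn (pseries log_todd_coef x).

Lemma log_todd_coef_le k : `|log_todd_coef k| <= 1.
Proof.
rewrite normrM normfV normr_nat; case: k => [|k].
  by rewrite invr0 mulr0.
by rewrite ler_pdivrMr // mul1r (le_trans (todd_coef_le _)) // ler1n.
Qed.

Lemma cvg_log_todd x : `|x| < 4^-1 -> pseries log_todd_coef x @ \oo --> log_todd x.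
Proof.
apply: (@cvg_pseries_geo _ 1) => n; apply: le_trans (log_todd_coef_le n) _.
by rewrite mul1r exprn_ege1 // ler1n.
Qed.

Lemma log_todd0 : log_todd 0 = 0.
Proof.
have cv : pseries log_todd_coef 0 @ \oo --> log_todd 0.
  by apply: cvg_log_todd; rewrite normr0.
apply: (cvg_unique _ cv) => //=.
rewrite [X in X @ _ --> _](_ : _ = fun=> 0); first exact: cvg_cst.
apply/funext => N; rewrite /pseries /series /= big1 // => -[|i] _.
  by rewrite /log_todd_coef invr0 mulr0 mul0r.
by rewrite exprS mul0r mulr0.
Qed.

(** Differentiation cancels the division by k, leaving the series of [todd] without its constant
    term 1 and shifted by one degree. *)
Lemma log_todd_derive x : `|x| < 8^-1 ->
  x * limn (pseries (pseries_diffs log_todd_coef) x) = todd x - 1.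
Proof.
move=> x_lt; have x4 : `|x| < 4^-1 by apply: lt_trans x_lt _; lra.
have diffsE : pseries_diffs log_todd_coef = fun n => todd_coef n.+1.
  by apply/funext => n; rewrite /pseries_diffs /log_todd_coef mulrC divfK.
have cv : pseries (fun n => todd_coef n.+1) x @ \oo
    --> limn (pseries (fun n => todd_coef n.+1) x).
  apply: (@cvg_pseries_geo _ 1) => // n; apply: le_trans (todd_coef_le _) _.
  by rewrite mul1r exprn_ege1 // ler1n.
have cv1 : (fun N => pseries todd_coef x N.+1 - 1) @ \oo --> todd x - 1.
  apply: cvgB; last exact: cvg_cst.
  by rewrite (cvg_shiftS (pseries todd_coef x)); apply: cvg_todd.
apply/esym; rewrite diffsE; apply: (cvg_unique _ cv1) => //=.
rewrite [X in X @ _ --> _](_ : _ = fun N => x * pseries (fun n => todd_coef n.+1) x N).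
  by apply: cvgM => //; apply: cvg_cst.
apply/funext => N; rewrite /pseries /series /= big_nat_recl // expr0 mulr1.
rewrite todd_coefE big_ord0 subr0 [1 + _]addrC addrK mulr_sumr.
by apply: eq_bigr => i _; rewrite exprS; ring.
Qed.

Lemma expR_sub1_log_todd x : `|x| < 8^-1 -> expR x - 1 = x * expR (log_todd x).
Proof.
move=> x_lt.
pose S' (y : R) : R := limn (pseries (pseries_diffs log_todd_coef) y).
pose T' (y : R) : R := limn (pseries (pseries_diffs todd_coef) y).
have dS (y : R) : `|y| < 8^-1 -> is_derive y 1 log_todd (S' y).
  exact: is_derive_pseries_geo log_todd_coef_le.
have dT (y : R) : `|y| < 8^-1 -> is_derive y 1 todd (T' y).
  exact: is_derive_pseries_geo todd_coef_le.
(* The derivative of the identity B(y) (1 - e^(-y)) = y, where B is [todd]. *)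
have eT (y : R) : `|y| < 8^-1 -> T' y * (1 - expR (- y)) + todd y * expR (- y) = 1.
  move=> y_lt.
  have d1 : is_derive y 1 (fun z => todd z * (1 - expR (- z)))
     (T' y * (1 - expR (- y)) + todd y * expR (- y)).
    have := dT y y_lt => dTy.
    by apply: is_derive_eq; rewrite /GRing.scale /=; ring.
  have d2 : is_derive y 1 id (T' y * (1 - expR (- y)) + todd y * expR (- y)).
    apply: near_eq_is_derive d1; near=> z; apply: todd_mul.
    apply: lt_trans (_ : 8^-1 < 4^-1); last by lra.
    by near: z; apply: cvgr_norm_lt y_lt.
  by have := @derive_val _ _ _ _ _ _ _ d2; rewrite derive_id.
pose Z (y : R) : R := todd y * expR (log_todd y - y).
pose Z' (y : R) : R := expR (log_todd y - y) * (T' y + todd y * (S' y - 1)).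
have dZ (y : R) : `|y| < 8^-1 -> is_derive y 1 Z (Z' y).
  move=> y_lt; have dSy := dS y y_lt; have dTy := dT y y_lt.
  by apply: is_derive_eq; rewrite /GRing.scale /Z' /=; ring.
(* Multiplying by y turns y S' into B - 1; replacing the other factors y by B (1 - e^(-y)) then
   gives a multiple of the identity [eT]. Cancelling y excludes y = 0. *)
have Z'0 (y : R) : `|y| < 8^-1 -> y != 0 -> Z' y = 0.
  move=> y_lt y0; apply: (mulfI y0); rewrite mulr0 /Z' mulrCA.
  have eS := log_todd_derive y_lt; rewrite -/(S' y) in eS.
  have y4 : `|y| < 4^-1 by apply: lt_trans y_lt _; lra.
  have eM := todd_mul y4; have eD := eT y y_lt.
  rewrite (_ : y * _ = 0) ?mulr0 //.
  have -> : y * (T' y + todd y * (S' y - 1)) =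
    y * T' y + todd y * (y * S' y) - y * todd y by ring.
  rewrite eS -[X in X * T' y]eM -[X in _ - X * _]eM.
  transitivity (todd y * (T' y * (1 - expR (- y)) + todd y * expR (- y) - 1)).
    by ring.
  by rewrite eD subrr mulr0.
have Z0 : Z 0 = 1 by rewrite /Z todd0 log_todd0 subrr expR0 mulr1.
have cZ (a b : R) : -8^-1 < a -> b < 8^-1 -> {within `[a, b], continuous Z}.
  move=> a_gt b_lt; apply: derivable_within_continuous => y.
  rewrite in_itv /= => /andP[ay yb].
  have /dZ[] // : `|y| < 8^-1 by rewrite ltr_norml; apply/andP; split; lra.
(* The mean value theorem uses the derivative only inside the interval, so 0 may be an endpoint and
   each side of 0 is treated separately. *)
have const (a b : R) : -8^-1 < a -> b < 8^-1 -> a < b ->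
    (forall y, a < y < b -> y != 0) -> Z a = Z b.
  move=> a_gt b_lt ab nz.
  have in_lt (y : R) : y \in `]a, b[%R -> `|y| < 8^-1.
    by rewrite in_itv /= ltr_norml => /andP[ay yb]; apply/andP; split; lra.
  have dab (y : R) : y \in `]a, b[%R -> is_derive y 1 Z (Z' y) by move/in_lt/dZ.
  have [y yab] := MVT ab dab (cZ _ _ a_gt b_lt).
  rewrite (Z'0 _ (in_lt _ yab)); last by apply: nz; move: yab; rewrite in_itv.
  by rewrite mul0r => /eqP; rewrite subr_eq0 eq_sym => /eqP.
have Zx : Z x = 1.
  move: x_lt; rewrite ltr_norml => /andP[x_gt x_lt].
  case: (ltrgt0P x) => [x0|x0|->//]; rewrite -Z0.
  - by apply/esym/const => // y /andP[y0 _]; rewrite gt_eqF.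
  - by apply: const => // y /andP[_ y0]; rewrite lt_eqF.
have x4 : `|x| < 4^-1 by apply: lt_trans x_lt _; lra.
have eM := todd_mul x4.
move: Zx; rewrite /Z expRD => Zx.
have eN : expR x * expR (- x) = 1 by rewrite -expRD subrr expR0.
have -> : x * expR (log_todd x) = todd x * (expR (log_todd x) * expR (- x))
    * (expR x - expR x * expR (- x)).
  transitivity (todd x * (1 - expR (- x)) * expR (log_todd x)
    * (expR x * expR (- x))).
    by rewrite eM eN mulr1.
  by ring.
by rewrite Zx eN mul1r.
Unshelve. all: by end_near.
Qed.

End BernoulliSeries.

(** * Uniqueness of power series coefficients *)

Section PowerSeriesUniqueness.

Variable R : realType.

(** Convergence at one point r bounds all c_k r^k by a constant C. At t = p r the terms with k >= 1
    add up to at most 2 C p, less than |c_0| for small p, so the partial sums could not tend to 0 if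
    c_0 != 0. *)
Lemma power_series_head0 (c : nat -> R) :
  (\forall t \near (0 : R)^',
     (fun N => \sum_(0 <= k < N) c k * t ^+ k) @ \oo --> (0 : R)) ->
  c 0%N = 0.
Proof.
case/nbhs_ballP => e /= e_gt0 ballP.
have cv t : 0 < t -> t < e ->
    (fun N => \sum_(0 <= k < N) c k * t ^+ k) @ \oo --> (0 : R).
  move=> t_gt0 te; apply: ballP; last by rewrite gt_eqF.
  by rewrite /ball /= sub0r normrN gtr0_norm.
pose r := e / 2.
have r_gt0 : 0 < r by rewrite divr_gt0.
have re : r < e by rewrite /r; lra.
have [C C_gt0 C_le] : exists2 C, 0 < C & forall k, `|c k * r ^+ k| <= C.
  have cvr : cvgn (series (fun k => c k * r ^+ k)) by apply/cvg_ex; exists 0; apply: cv.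
  have [K [_ KP]] := cvg_series_bounded cvr.
  exists (`|K| + 1); first by rewrite ltr_wpDl.
  by move=> k; apply: KP => //; rewrite ltr_pwDr // ler_norm.
apply/eqP; rewrite -normr_le0 leNgt; apply/negP => c0_gt0.
(* The first bound makes the geometric sum at most 2, the second gives 2 C p <= |c_0| / 2. *)
pose p := Num.min 2^-1 (`|c 0%N| / (4 * C)).
have p_gt0 : 0 < p by rewrite lt_min invr_gt0 ltr0n divr_gt0 // mulr_gt0.
have p_half : p <= 2^-1 by rewrite ge_min lexx.
have pC : 2 * (C * p) < `|c 0%N|.
  have : p <= `|c 0%N| / (4 * C) by rewrite ge_min lexx orbT.
  rewrite ler_pdivlMr ?mulr_gt0 // => h.
  have : 0 < p * C by rewrite mulr_gt0.
  by lra.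
have geo N : \sum_(0 <= k < N) p ^+ k <= 2.
  rewrite -[leLHS]mul1r; have : (1 - p) * (\sum_(0 <= k < N) p ^+ k) <= 1.
    by rewrite big_mkord -opprB mulNr -subrX1 opprB gerBl exprn_ge0 // ltW.
  have : 0 <= \sum_(0 <= k < N) p ^+ k.
    by apply: sumr_ge0 => k _; rewrite exprn_ge0 // ltW.
  by nra.
have pr_lt : p * r < e by apply: le_lt_trans re; rewrite ler_piMl //; lra.
have pr_gt0 : 0 < p * r by rewrite mulr_gt0.
have gap : 0 < `|c 0%N| - 2 * (C * p) by rewrite subr_gt0.
have [N _ /(_ N.+1 (leqnSn N))] := (cvgr0_norm_lt _ (cv _ pr_gt0 pr_lt)) _ gap.
apply/negP; rewrite -leNgt big_nat_recl // expr0 mulr1 lerBlDr.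
set s := \sum_(0 <= i < N) _.
have s_le : `|s| <= 2 * (C * p).
  apply: le_trans (ler_norm_sum _ _ _) _.
  apply: (@le_trans _ _ (\sum_(0 <= i < N) C * p * p ^+ i)).
    apply: ler_sum => i _; rewrite exprMn mulrCA mulrC normrM -[leRHS]mulrA -exprS.
    rewrite [X in _ * X]ger0_norm; last by rewrite exprn_ge0 // ltW.
    by apply: ler_wpM2r => //; rewrite exprn_ge0 // ltW.
  rewrite -mulr_sumr mulrC; apply: ler_wpM2r => //.
  by rewrite mulr_ge0 // ltW.
rewrite -{1}[c 0%N](addrK s); apply: le_trans (ler_normB _ _) _.
by rewrite lerD2l.
Qed.

(** Once c_0 = 0, division by t != 0 shifts the coefficients down by one. *)
Lemma power_series_eq0 (c : nat -> R) :
  (\forall t \near (0 : R)^',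
     (fun N => \sum_(0 <= k < N) c k * t ^+ k) @ \oo --> (0 : R)) ->
  forall k, c k = 0.
Proof.
move=> cv k; elim: k c cv => [|k IHk] c cv; first exact: power_series_head0.
have c0 := power_series_head0 cv.
apply: (IHk (c \o succn)); have nz := nbhs_dnbhs_neq (0 : R).
near=> t; have t0 : t != 0 by near: t.
have cvt : (fun N => \sum_(0 <= k < N) c k * t ^+ k) @ \oo --> (0 : R) by near: t.
rewrite (_ : (fun N => _) = fun N => t^-1 * \sum_(0 <= k < N.+1) c k * t ^+ k).
  rewrite -[X in _ --> X](mulr0 t^-1); apply: cvgM; first exact: cvg_cst.
  have := cvt; rewrite -(cvg_shiftS (fun N => \sum_(0 <= k < N) c k * t ^+ k)). exact.
apply/funext => N; rewrite big_nat_recl // c0 mul0r add0r mulr_sumr.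
by apply: eq_bigr => i _; rewrite /= exprS; field.
Unshelve. all: by end_near.
Qed.

Lemma power_series_inj (c c' : nat -> R) (l : R -> R) :
  (\forall t \near (0 : R)^',
     (fun N => \sum_(0 <= k < N) c k * t ^+ k) @ \oo --> l t) ->
  (\forall t \near (0 : R)^',
     (fun N => \sum_(0 <= k < N) c' k * t ^+ k) @ \oo --> l t) ->
  c =1 c'.
Proof.
move=> cvc cvc' k; apply/eqP; rewrite -subr_eq0; apply/eqP.
apply: (@power_series_eq0 (fun k => c k - c' k)); near=> t.
rewrite (_ : (fun N => _) = fun N => \sum_(0 <= k < N) c k * t ^+ k
    - \sum_(0 <= k < N) c' k * t ^+ k).
  by rewrite -[X in _ --> X](subrr (l t)); apply: cvgB; near: t.
by apply/funext => N; rewrite -sumrB; apply: eq_bigr => i _; rewrite mulrBl.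
Unshelve. all: by end_near.
Qed.

End PowerSeriesUniqueness.

(** * Expectations of functions of a uniform random element *)

Section UniformExpectation.

Variables (d : measure_display) (Omega : measurableType d) (R : realType).
Variables (P : probability Omega R) (A : finType) (T : Omega -> A).
Hypothesis T_unif : uniformly_distributed P T.

(** The integrand is a finite combination of indicators of the fibres of [T]; for nonnegative terms
    the integral is additive without integrability conditions. *)
Lemma expectation_uniform (g : A -> R) : (forall a, 0 <= g a) ->
  'E_P[fun w => g (T w)]%E = ((\sum_(a : A) g a) / #|A|%:R)%:E.
Proof.
move=> g_ge0; have [mT PT] : (forall a, measurable (T @^-1` [set a]))
    /\ (forall a, P (T @^-1` [set a]) = (#|A|%:R^-1)%:E).
  by split=> a; have [] := T_unif a.
rewrite unlock.
pose f a w := (g a * \1_(T @^-1` [set a]) w)%:E.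
under eq_integral => w _.
  have -> : (g (T w))%:E = (\sum_(a <- enum A) f a w)%E.
    rewrite big_enum (bigD1 (T w)) //= big1 ?adde0 => [|a aT].
      by rewrite /f indicE mem_set ?mulr1.
    by rewrite /f indicE memNset ?mulr0 //= => Ta; rewrite Ta eqxx in aT.
  over.
rewrite ge0_integral_sum //; last 2 first.
- move=> a; apply/measurable_EFinP; apply: measurable_funM => //.
- by move=> a w _; rewrite lee_fin mulr_ge0.
rewrite big_enum /= mulr_suml -sumEFin; apply: eq_bigr => a _.
rewrite /f (@integralZl_indic _ _ _ P _ _ (fun=> T @^-1` [set a])) //; last first.
  by move=> /lt_geF; rewrite g_ge0.
by rewrite integral_indic // setIT EFinM; congr (_ * _)%E; apply: PT.
Qed.

(** Total mass 1 makes [Omega] nonempty. This supplies a standard tableau without constructing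
    one. *)
Lemma uniform_card_gt0 : (0 < #|A|)%N.
Proof.
rewrite lt0n; apply/eqP => A0.
have : P setT = 0%E.
  rewrite (_ : setT = set0) ?measure0 //; apply/seteqP; split=> // w _.
  by have := card0_eq A0 (T w).
by rewrite probability_setT => /eqP; rewrite onee_eq0.
Qed.

End UniformExpectation.

(** * The cumulant generating function of maj *)

Section CumulantGeneratingFunction.

Variables (R : realType) (n : nat) (lam : seq nat).
Hypothesis lamP : is_partition n lam.

(** A crude common bound for 1, ..., n and all hook lengths k; for |t| < [cgf_radius] every k t lies
    in the range |x| < 1/8 of [expR_sub1_log_todd]. *)
Definition hook_bound : nat := (n + \sum_(c : cell lam) hook_length c)%N.
Definition cgf_radius : R := (8 * hook_bound.+1%:R)^-1.

Lemma cgf_radius_gt0 : 0 < cgf_radius.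
Proof. by rewrite /cgf_radius invr_gt0 mulr_gt0. Qed.

Lemma small_mul k t : (k <= hook_bound)%N -> `|t| < cgf_radius -> `|k%:R * t| < 8^-1.
Proof.
move=> k_le t_lt; rewrite normrM normr_nat.
apply: (@le_lt_trans _ _ (hook_bound.+1%:R * `|t|)).
  by rewrite ler_wpM2r // ler_nat (leq_trans k_le).
rewrite mulrC -ltr_pdivlMr //; apply: lt_le_trans t_lt _.
by rewrite /cgf_radius invfM.
Qed.

Lemma hook_length_bound (c : cell lam) : (hook_length c <= hook_bound)%N.
Proof. by rewrite /hook_bound (bigD1 c) //= addnCA leq_addr. Qed.

Lemma hook_length_gt0 (c : cell lam) : (0 < hook_length c)%N.
Proof.
by rewrite card_gt0; apply/set0Pn; exists c; rewrite inE eqxx leqnn.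
Qed.

Definition log_mgf (t : R) : R :=
  (\sum_(i < size lam) i * nth 0%N lam i)%:R * t
  + \sum_(k < n) log_todd (k.+1%:R * t)
  - \sum_(c : cell lam) log_todd ((hook_length c)%:R * t).

(** Each factor is 1 - e^(h t) = (- t) h e^(S(h t)), with S the function [log_todd]. *)
Lemma prod_one_sub_expR (I : finType) (h : I -> nat) t : `|t| < cgf_radius ->
  (forall i, (h i <= hook_bound)%N) ->
  \prod_i (1 - expR t ^+ h i)
  = (- t) ^+ #|I| * (\prod_i (h i)%:R) * expR (\sum_i log_todd ((h i)%:R * t)).
Proof.
move=> t_lt h_le; have -> : (- t) ^+ #|I| = \prod_(i : I) (- t).
  by rewrite -prodr_const; apply: eq_bigl.
rewrite expR_sum -!big_split /=.
apply: eq_bigr => i _; rewrite -expRM_natl -opprB.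
by rewrite (expR_sub1_log_todd (small_mul (h_le i) t_lt)); ring.
Qed.

(** The q-hook length formula at q = e^t: there are as many cells as factors 1 - q^k, so the powers
    of - t cancel. *)
Lemma sum_syt_expR t : `|t| < cgf_radius -> t != 0 ->
  \sum_(T : syt n lam) expR ((maj T)%:R * t)
  = (n`!%:R / \prod_(c : cell lam) (hook_length c)%:R) * expR (log_mgf t).
Proof.
move=> t_lt t0; under eq_bigr => T _ do rewrite expRM_natl.
have q1 k : expR t ^+ k.+1 != 1.
  rewrite -expRM_natl -[X in _ != X]expR0; apply/eqP => /expR_inj/eqP.
  by rewrite mulf_eq0 pnatr_eq0 (negPf t0).
have := sum_syt_hook lamP q1 (lt0r_neq0 (expR_gt0 t)).
rewrite (prod_one_sub_expR t_lt hook_length_bound).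
rewrite (prod_one_sub_expR t_lt (h := fun k : 'I_n => k.+1)); last first.
  by move=> k; rewrite (leq_trans (ltn_ord k)) // leq_addr.
rewrite (card_cell lamP) card_ord -expRM_natl.
have -> : \prod_(k < n) k.+1%:R = n`!%:R :> R.
  by rewrite fact_prod natr_prod big_add1 big_mkord.
have H0 : \prod_(c : cell lam) (hook_length c)%:R != 0 :> R.
  by apply/prodf_neq0 => c _; rewrite pnatr_eq0 -lt0n hook_length_gt0.
have t0n : (- t) ^+ n != 0 by rewrite expf_neq0 // oppr_eq0.
rewrite /log_mgf 2!expRD expRN.
set E := expR (\sum_(c : cell lam) _); have E0 : E != 0 by rewrite gt_eqF ?expR_gt0.
move: (\sum_T _) (\prod_c _) (expR (\sum_(k < n) _)) (expR (_ * t)) H0.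
move=> S H E1 E2 H0 eqS; apply: (mulIf (mulf_neq0 (mulf_neq0 t0n H0) E0)).
by rewrite eqS; field; rewrite H0 E0.
Qed.

Lemma log_mgf0 : log_mgf 0 = 0.
Proof.
by rewrite /log_mgf mulr0 !big1 ?addr0 ?subr0 // => *; rewrite mulr0 log_todd0.
Qed.

Lemma cvg_sumr (I U : Type) (F : set_system U) (r : seq I) (f : I -> U -> R) l :
  Filter F -> (forall i, f i @ F --> l i) ->
  (fun x => \sum_(i <- r) f i x) @ F --> \sum_(i <- r) l i.
Proof. by move=> FF cvf; apply: cvg_big => //; apply: add_continuous. Qed.

Lemma log_mgf_cvg0 : log_mgf t @[t --> (0 : R)] --> (0 : R).
Proof.
have cvL (k : nat) : log_todd (k%:R * t) @[t --> (0 : R)] --> (0 : R).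
  have dL : is_derive (0 : R) 1 (@log_todd R)
      (limn (pseries (pseries_diffs (@log_todd_coef R)) 0)).
    by apply: is_derive_pseries_geo; [apply: log_todd_coef_le | rewrite normr0].
  have cL : {for 0, continuous (@log_todd R)}.
    by apply/differentiable_continuous/derivable1_diffP.
  have cvk : k%:R * t @[t --> (0 : R)] --> (0 : R).
    rewrite -[X in _ --> X](mulr0 k%:R).
    by apply: cvgM; [exact: cvg_cst | exact: cvg_id].
  by rewrite -[X in _ --> X]log_todd0; apply: cvg_comp cvk cL.
rewrite -[X in _ --> X]log_mgf0 /log_mgf.
apply: cvgB; last first.
  under [X in _ --> X]eq_bigr => c _ do rewrite mulr0 log_todd0.
  exact: cvg_sumr.
apply: cvgD; first by apply: cvgM; [exact: cvg_cst | exact: cvg_id].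
under [X in _ --> X]eq_bigr => c _ do rewrite mulr0 log_todd0.
exact: cvg_sumr.
Qed.

(** The constant [K] is found by letting u tend to 0: the mean tends to 1 and [log_mgf] to 0, so K =
    1. This recovers the hook length formula for the number of tableaux. *)
Lemma maj_mean_expR t : (0 < #|{: syt n lam}|)%N -> `|t| < cgf_radius ->
  (\sum_(T : syt n lam) expR ((maj T)%:R * t)) / #|{: syt n lam}|%:R
  = expR (log_mgf t).
Proof.
set N := #|{: syt n lam}| => N_gt0 t_lt.
pose M (t : R) : R := (\sum_(T : syt n lam) expR ((maj T)%:R * t)) / N%:R.
have N0 : N%:R != 0 :> R by rewrite pnatr_eq0 -lt0n.
have M0 : M 0 = 1.
  rewrite /M (eq_bigr (fun=> 1)) => [|T _]; last by rewrite mulr0 expR0.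
  by rewrite sumr_const -/N divff.
pose K := n`!%:R / (\prod_(c : cell lam) (hook_length c)%:R) / N%:R : R.
have MK (u : R) : `|u| < cgf_radius -> u != 0 -> M u = K * expR (log_mgf u).
  by move=> u_lt u0; rewrite /M sum_syt_expR // /K mulrAC.
case: (eqVneq t 0) => [->|t0]; first by rewrite log_mgf0 expR0 -/(M 0).
suff K1 : K = 1 by rewrite -/(M t) MK // K1 mul1r.
have cvM : M u @[u --> (0 : R)^'] --> (1 : R).
  rewrite -[X in _ --> X]M0; apply: cvg_within_filter; apply: cvgM; last exact: cvg_cst.
  apply: cvg_sumr => T.
  have cvT : (maj T)%:R * u @[u --> (0 : R)] --> (maj T)%:R * (0 : R).
    by apply: cvgM; [exact: cvg_cst | exact: cvg_id].
  exact: cvg_comp cvT (@continuous_expR R _).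
have cvE : expR (log_mgf u) @[u --> (0 : R)] --> (1 : R).
  rewrite -[X in _ --> X]expR0.
  exact: cvg_comp log_mgf_cvg0 (@continuous_expR R _).
have cvK : K * expR (log_mgf u) @[u --> (0 : R)^'] --> K.
  rewrite -[X in _ --> X]mulr1.
  by apply: cvg_within_filter; apply: cvgM => //; apply: cvg_cst.
apply: (cvg_unique _ cvK) => //=.
apply: cvg_trans cvM; apply: near_eq_cvg.
have small : \forall u \near (0 : R)^', `|u| < cgf_radius.
  by apply: dnbhs0_lt cgf_radius_gt0.
have nz := nbhs_dnbhs_neq (0 : R).
near=> u; have u_lt : `|u| < cgf_radius by near: u.
by apply: MK => //; near: u.
Unshelve. all: by end_near.
Qed.

(** [k!] times the coefficient of t^k in [log_mgf] for k > 0; the linear term b t enters only at k =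
    1. *)
Definition maj_kappa k : R :=
  k`!%:R * ((k == 1%N)%:R * (\sum_(i < size lam) i * nth 0%N lam i)%:R
    + log_todd_coef R k * (\sum_(j < n) j.+1%:R ^+ k
       - \sum_(c : cell lam) (hook_length c)%:R ^+ k)).

Lemma cvg_maj_kappa t : `|t| < cgf_radius ->
  (fun N => \sum_(1 <= k < N) maj_kappa k * t ^+ k / k`!%:R) @ \oo --> log_mgf t.
Proof.
move=> t_lt.
pose b : R := (\sum_(i < size lam) i * nth 0%N lam i)%:R.
have cvL k : (k <= hook_bound)%N ->
    pseries (@log_todd_coef R) (k%:R * t) @ \oo --> log_todd (k%:R * t).
  move=> k_le; apply: cvg_log_todd; apply: lt_trans (small_mul k_le t_lt) _; lra.
rewrite [X in X @ _ --> _](_ : _ = fun N =>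
   (\sum_(1 <= k < N) (k == 1%N)%:R * b * t ^+ k
    + \sum_(j < n) pseries (@log_todd_coef R) (j.+1%:R * t) N)
    - \sum_(c : cell lam) pseries (@log_todd_coef R) ((hook_length c)%:R * t) N).
  apply: cvgB; last by apply: cvg_sumr => c; apply/cvL/hook_length_bound.
  apply: cvgD; last first.
    by apply: cvg_sumr => j; apply: cvL; rewrite (leq_trans (ltn_ord j)) // leq_addr.
  (* From N = 2 on, this sum consists of the single term b t. *)
  rewrite -(cvg_shiftn 2) /=; rewrite [X in X @ _ --> _](_ : _ = fun=> b * t).
    exact: cvg_cst.
  apply/funext => N; rewrite addn2 big_ltn // expr1 mul1r big_nat_cond big1 ?addr0 //.
  by move=> k /andP[/andP[k_gt1 _] _]; rewrite gtn_eqF // !mul0r.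
have psE N u : pseries (@log_todd_coef R) u N
    = \sum_(1 <= k < N) log_todd_coef R k * u ^+ k.
  rewrite /pseries /series /=; case: N => [|N]; first by rewrite !big_geq.
  by rewrite big_ltn // /log_todd_coef invr0 mulr0 mul0r add0r.
apply/funext => N.
under [X in _ + X - _]eq_bigr => j _ do rewrite psE.
under [X in _ - X]eq_bigr => c _ do rewrite psE.
rewrite exchange_big [X in _ - X]exchange_big -big_split -sumrB /=.
apply: eq_bigr => k _; have k0 : k`!%:R != 0 :> R by rewrite pnatr_eq0 -lt0n fact_gt0.
under [X in _ + X - _]eq_bigr => j _ do rewrite exprMn mulrCA.
under [X in _ - X]eq_bigr => c _ do rewrite exprMn mulrCA.
rewrite -!mulr_suml /maj_kappa -/b.
by field.
Qed.

End CumulantGeneratingFunction.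

(** * Bernoulli numbers and the cumulant formula *)

Lemma bernoulli_number_todd (R : realType) k :
  bernoulli_number R k = todd_coef R k * k`!%:R.
Proof.
have factr_neq0 i : i`!%:R != 0 :> R by rewrite pnatr_eq0 -lt0n fact_gt0.
have isB : is_bernoulli (fun i => todd_coef R i * i`!%:R).
  have small : \forall t \near (0 : R)^', `|t| < 4^-1.
    by apply: dnbhs0_lt; rewrite invr_gt0.
  have nz := nbhs_dnbhs_neq (0 : R).
  near=> t; have t0 : t != 0 by near: t.
  have t_lt : `|t| < 4^-1 by near: t.
  have den0 : 1 - expR (- t) != 0.
    rewrite subr_eq0 eq_sym -expR0; apply: contraNneq t0 => /expR_inj /eqP.
    by rewrite oppr_eq0.
  have -> : t / (1 - expR (- t)) = todd t by rewrite -[X in X / _](todd_mul t_lt) mulfK.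
  rewrite [X in X @ _ --> _](_ : _ = pseries (@todd_coef R) t); first exact: cvg_todd.
  by apply/funext => N; apply: eq_bigr => i _; rewrite mulrAC mulfK.
(* By [isB] such a sequence exists, so [xget] returns one; uniqueness of coefficients then
   identifies the two. *)
have isB' : is_bernoulli (bernoulli_number R).
  exact: (@xgetPex _ (fun=> 0) [set B | is_bernoulli B] (ex_intro _ _ isB)).
have series_c B (Bp : is_bernoulli B) : \forall t \near (0 : R)^',
    (fun N => \sum_(0 <= i < N) B i / i`!%:R * t ^+ i) @ \oo
      --> t / (1 - expR (- t)).
  apply: filterS Bp => t cvB; rewrite [X in X @ _ --> _](_ : _ =
    fun N => \sum_(0 <= i < N) B i * t ^+ i / i`!%:R) //.
  by apply/funext => N; apply: eq_bigr => i _; rewrite mulrAC.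
apply: (divIf (factr_neq0 k)).
exact: power_series_inj (series_c _ isB') (series_c _ isB) k.
Unshelve. all: by end_near.
Qed.

Theorem theorem1p5 (R : realType) (n : nat) (lam : seq nat)
    (hlam : is_partition n lam) (d : nat) (hd : (1 < d)%N)
    (disp : measure_display) (Omega : measurableType disp)
    (P : probability Omega R) (T : Omega -> syt n lam)
    (hT : uniformly_distributed P T) :
  cumulant P (fun w => (maj (T w))%:R) d
  = bernoulli_number R d / d%:R
    * (\sum_(1 <= j < n.+1) j%:R ^+ d
       - \sum_(c : cell lam) (hook_length c)%:R ^+ d).
Proof.
have mgfE t : 'M_P (fun w => (maj (T w))%:R : R) t
    = ((\sum_(a : syt n lam) expR ((maj a)%:R * t)) / #|{: syt n lam}|%:R)%:E.
  rewrite /mmt_gen_fun.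
  apply: (expectation_uniform hT (g := fun a => expR ((maj a)%:R * t))) => a.
  exact: expR_ge0.
have kappaP : has_cumulants P (fun w => (maj (T w))%:R) (@maj_kappa R n lam).
  have small : \forall t \near (0 : R), `|t| < cgf_radius R n lam
    by apply: nbhs0_lt (cgf_radius_gt0 R n lam).
  apply: filterS small => t t_lt; rewrite mgfE; split=> //=.
  rewrite (maj_mean_expR hlam (uniform_card_gt0 P T) t_lt) expRK.
  exact: cvg_maj_kappa.
have factr_neq0 i : i`!%:R != 0 :> R by rewrite pnatr_eq0 -lt0n fact_gt0.
set X := fun w => _.
have cumP : has_cumulants P X (cumulant P X).
  exact: (@xgetPex _ (fun=> 0) [set k | has_cumulants P X k] (ex_intro _ _ kappaP)).
(* The value [kappa 0] is unconstrained, so the constant coefficient is set to 0 before uniqueness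
   is applied. *)
pose c (kappa : nat -> R) k := if k is 0 then 0 else kappa k / k`!%:R.
have cE kappa N t : \sum_(0 <= k < N) c kappa k * t ^+ k
    = \sum_(1 <= k < N) kappa k * t ^+ k / k`!%:R.
  case: N => [|N]; first by rewrite !big_geq.
  rewrite big_ltn //= mul0r add0r big_nat_cond [RHS]big_nat_cond.
  by apply: eq_bigr => -[|k] // _; rewrite /= mulrAC.
have cvc kappa : has_cumulants P X kappa -> \forall t \near (0 : R)^',
    (fun N => \sum_(0 <= k < N) c kappa k * t ^+ k) @ \oo --> ln (fine ('M_P X t)).
  move=> kP; apply: cvg_within; apply: filterS kP => t [_].
  move=> cvk; rewrite [X in X @ _ --> _](_ : _ =
    fun N => \sum_(1 <= k < N) kappa k * t ^+ k / k`!%:R) //.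
  by apply/funext => N; rewrite cE.
have := power_series_inj (cvc _ cumP) (cvc _ kappaP) d.
case: d hd => [//|d'] d_gt0 /(divIf (factr_neq0 _)) ->.
(* Since d > 1, the linear term b t does not contribute. *)
rewrite /maj_kappa gtn_eqF // mul0r add0r bernoulli_number_todd /log_todd_coef.
by rewrite big_add1 big_mkord /=; ring.
Qed.
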